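(* Let $1\le r\le\min\{p_1,p_2\}$, $L\in\mathbb{R}^{p_1\times r}_*$, $R\in\mathbb{R}^{p_2\times r}_*$, $X=LR^\top$, let $U\in\mathrm{St}(r,p_1)$, $V\in\mathrm{St}(r,p_2)$ span the top $r$ left and right singular subspaces of $X$. Suppose the weights in $\bar g^r_{(L,R)}$ satisfy $W_{L,R}=MW_{LM,RM^{-\top}}M^\top$ and $V_{L,R}=M^{-\top}V_{LM,RM^{-\top}}M^{-1}$ for all $(L,R)$ and all $M\in\mathrm{GL}(r)$. Then $$\operatorname{grad}f(X)=\overline{\operatorname{grad}_Lh_r([L,R])}\,W_{L,R}R^\dagger+\big(\overline{\operatorname{grad}_Rh_r([L,R])}\,V_{L,R}L^\dagger\big)^\top(I_{p_2}-RR^\dagger),$$ $$\overline{\operatorname{grad}h_r([L,R])}=\begin{bmatrix}\overline{\operatorname{grad}_Lh_r([L,R])}\\ \overline{\operatorname{grad}_Rh_r([L,R])}\end{bmatrix}=\begin{bmatrix}\operatorname{grad}f(X)\,R\,W_{L,R}^{-1}\\(\operatorname{grad}f(X))^\top L\,V_{L,R}^{-1}\end{bmatrix}.$$ Furthermore, if $[L,R]$ is a Riemannian first-order stationary point of $h_r$ on $\mathcal{M}^{q_1}_r$, then $$\overline{\operatorname{Hess}h_r([L,R])}[\theta_{(L,R)},\theta_{(L,R)}]=\operatorname{Hess}f(X)\big[\mathcal{L}^r_{L,R}(\theta_{(L,R)}),\mathcal{L}^r_{L,R}(\theta_{(L,R)})\big]\qquad\forall\,\theta_{(L,R)}\in\mathcal{H}_{(L,R)}\overline{\mathcal{M}}^{q_1}_r.$$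 Finally (at such a point), $\overline{\operatorname{Hess}h_r([L,R])}$ and $\operatorname{Hess}f(X)$ both have $(p_1+p_2-r)r$ eigenvalues, and for $i=1,\dots,(p_1+p_2-r)r$, $\lambda_i(\overline{\operatorname{Hess}h_r([L,R])})$ is sandwiched between $\overline\gamma\,\lambda_i(\operatorname{Hess}f(X))$ and $2\underline\Gamma\,\lambda_i(\operatorname{Hess}f(X))$, where $\overline\gamma=\sup_{L,R:LR^\top=X}\gamma_{L,R}$ and $\underline\Gamma=\inf_{L,R:LR^\top=X}\Gamma_{L,R}$, with $$\gamma_{L,R}=\sigma_r(P_2W_{L,R}^{-1}P_2^\top)\wedge\sigma_r(P_1V_{L,R}^{-1}P_1^\top),\qquad\Gamma_{L,R}=\sigma_1(P_2W_{L,R}^{-1}P_2^\top)\vee\sigma_1(P_1V_{L,R}^{-1}P_1^\top),$$ $P_1=U^\top L$, $P_2=V^\top R$.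
   Context: Notation: $\mathbb{R}^{p\times r}_*$ = full-column-rank $p\times r$ matrices; $\mathrm{St}(r,p)$ = $p\times r$ matrices with orthonormal columns; $\mathbb{S}_+(r)$ = $r\times r$ symmetric positive definite matrices; $\mathrm{GL}(r)$ = invertible $r\times r$ matrices; $U_\perp$ = orthonormal complement of $U$; $\dagger$ = Moore–Penrose inverse; $\sigma_i,\lambda_i$ = $i$-th largest singular value/eigenvalue; $a\wedge b=\min$, $a\vee b=\max$. ''$a$ is sandwiched between $b$ and $c$'' means $\min\{b,c\}\le a\le\max\{b,c\}$. Objective: $f:\mathbb{R}^{p_1\times p_2}\to\mathbb{R}$ is twice continuously differentiable. Embedded geometry: $\mathcal{M}^e_r=\{X\in\mathbb{R}^{p_1\times p_2}:\operatorname{rank}X=r\}$, an embedded submanifold of dimension $(p_1+p_2-r)r$ with the metric induced by the Euclidean inner product. $\operatorname{grad}f(X)$, $\operatorname{Hess}f(X)$ are the Riemannian gradient and Hessian of $f|_{\mathcal{M}^e_r}$. Quotient geometry $\mathcal{M}^{q_1}_r$: total space $\overline{\mathcal{M}}^{q_1}_r=\mathbb{R}^{p_1\times r}_*\times\mathbb{R}^{p_2\times r}_*$, equivalence classes $[L,R]=\{(LM,RM^{-\top}):M\in\mathrm{GL}(r)\}$, $\mathcal{M}^{q_1}_r=\overline{\mathcal{M}}^{q_1}_r/\mathrm{GL}(r)$ with quotient map $\pi$. Tangent vectors are written $\theta_{(L,R)}=[\theta_L^\top\ \ \theta_R^\top]^\top$. The total space carries the Riemannian metric $\bar g^r_{(L,R)}(\eta,\theta)=\operatorname{tr}(W_{L,R}\eta_L^\top\theta_L)+\operatorname{tr}(V_{L,R}\eta_R^\top\theta_R)$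 with $W_{L,R},V_{L,R}\in\mathbb{S}_+(r)$ depending smoothly on $(L,R)$. With $U,V$ spanning the left/right singular subspaces of $LR^\top$, $P_1=U^\top L$, $P_2=V^\top R$, the horizontal space $\mathcal{H}_{(L,R)}\overline{\mathcal{M}}^{q_1}_r$ (the $\bar g^r$-orthogonal complement of the tangent space of the fiber) consists of all $[\theta_L^\top\ \ \theta_R^\top]^\top$ with $$\theta_L=(USP_2W_{L,R}^{-1}P_2^\top+U_\perp D_1)P_2^{-\top},\quad\theta_R=(VS^\top P_1V_{L,R}^{-1}P_1^\top+V_\perp D_2)P_1^{-\top},$$ $S\in\mathbb{R}^{r\times r}$, $D_1\in\mathbb{R}^{(p_1-r)\times r}$, $D_2\in\mathbb{R}^{(p_2-r)\times r}$. The horizontal lift at $(L,R)$ of a tangent vector $\theta_{[L,R]}$ is the unique horizontal $\theta_{(L,R)}$ with $\mathrm{D}\pi(L,R)[\theta_{(L,R)}]=\theta_{[L,R]}$; the quotient metric is $g^r_{[L,R]}(\eta_{[L,R]},\theta_{[L,R]})=\bar g^r_{(L,R)}(\eta_{(L,R)},\theta_{(L,R)})$. $h_r([L,R])=f(LR^\top)$. $\overline{\operatorname{grad}h_r([L,R])}$ is the horizontal lift of the Riemannian gradient (with $L$- and $R$-components), and $\overline{\operatorname{Hess}h_r([L,R])}[\theta_{(L,R)},\eta_{(L,R)}]=\operatorname{Hess}h_r([L,R])[\theta_{[L,R]},\eta_{[L,R]}]$ is the bilinear form of the Riemannian Hessian, on the horizontal space; its eigenvalues are those of the corresponding self-adjoint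 operator on the horizontal space with inner product $\bar g^r_{(L,R)}$. A Riemannian first-order stationary point is a point where the Riemannian gradient vanishes. The map $\mathcal{L}^r_{L,R}:\mathcal{H}_{(L,R)}\overline{\mathcal{M}}^{q_1}_r\to T_X\mathcal{M}^e_r$ is $\mathcal{L}^r_{L,R}(\theta_{(L,R)})=L\theta_R^\top+\theta_LR^\top$. *)

(* Defs.v *)
From HB Require Import structures.
From mathcomp Require Import all_boot all_order all_algebra.
From mathcomp Require Import all_classical all_reals all_analysis.

Set Implicit Arguments.
Unset Strict Implicit.
Unset Printing Implicit Defensive.

Import Order.TTheory GRing.Theory Num.Theory.
Import numFieldNormedType.Exports.

Local Open Scope classical_set_scope.
Local Open Scope ring_scope.

Section Regularity.
Context {K : realType} {E F : normedModType K}.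

(* In finite dimension, continuity of [y |-> 'D_v f y] for every fixed [v] is
   continuity of the differential as a map into linear maps, so on an open [O]
   this is the usual C^k. *)
Fixpoint Ck (k : nat) (O : set E) (f : E -> F) : Prop :=
  match k with
  | 0%N => forall x, O x -> {for x, continuous f}
  | k'.+1 => (forall x, O x -> differentiable f x) /\
             (forall v : E, Ck k' O ('D_v f))
  end.

(* C^k on a subset, usually a submanifold: local C^k extensions exist. *)
Definition Ck_on (k : nat) (M : set E) (f : E -> F) : Prop :=
  forall x, M x -> exists (O : set E) (g : E -> F),
    [/\ open O, O x, Ck k O g & forall y, O y -> M y -> f y = g y].

End Regularity.

Section Riemannian.
Context {K : realType} {E : normedModType K}.

Definition curve_at (M : set E) (x v : E) (c : K -> E) : Prop :=
  [/\ c 0 = x, \forall t \near (0 : K), M (c t)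
    & is_derive (0 : K) (1 : K) c v].

(* For an embedded submanifold [M], asking for differentiability of the curve
   at 0 only gives the same velocities as asking for a smooth curve. *)
Definition tangent_space (M : set E) (x : E) : set E :=
  [set v | exists c, curve_at M x v c].

(* Common format for a Riemannian submanifold of [E] and for a Riemannian
   quotient of a submanifold of [E].  In the quotient case everything is
   expressed through lifts: tangent vectors are horizontal vectors, functions
   are the invariant functions on the total space, and vector fields are the
   horizontal fields that descend to the quotient. *)
Record geometry := Geometry {
  points : set E;
  tangent : E -> set E;
  metric : E -> E -> E -> K;
  functions : set (E -> K);   (* C^1 functions *)
  fields : set (E -> E)       (* C^1 vector fields *)
}.

(* The Riemannian connection, [nabla x xi Y] being nabla_xi Y for a tangent
   vector xi at x.  Vector fields are C^1 and not C^infinity, so that the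
   gradient of a C^2 function is one of them.  The bracket [X,Y] at x is
   DY[X] - DX[Y] in [E]; pairing it with tangent vectors only means that in the
   quotient case its horizontal part is taken, i.e. the lift of the bracket of
   the two fields on the quotient.  Regularity of nabla is not required: by the
   Koszul formula these axioms determine nabla uniquely. *)
Record levi_civita (G : geometry) (nabla : E -> E -> (E -> E) -> E) : Prop := {
  lc_tangent : forall x xi Y, points G x -> tangent G x xi -> fields G Y ->
    tangent G x (nabla x xi Y);
  lc_linear : forall x (a : K) xi zeta Y, points G x -> tangent G x xi ->
    tangent G x zeta -> fields G Y ->
    nabla x (a *: xi + zeta) Y = a *: nabla x xi Y + nabla x zeta Y;
  lc_additive : forall x xi Y Z, points G x -> tangent G x xi ->
    fields G Y -> fields G Z ->
    nabla x xi (fun y => Y y + Z y) = nabla x xi Y + nabla x xi Z;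
  lc_leibniz : forall x xi phi Y c, points G x -> tangent G x xi ->
    functions G phi -> fields G Y -> curve_at (points G) x xi c ->
    nabla x xi (fun y => phi y *: Y y) =
      'D_(1 : K) (fun t => phi (c t)) (0 : K) *: Y x + phi x *: nabla x xi Y;
  lc_torsion_free : forall x X Y cX cY zeta, points G x ->
    fields G X -> fields G Y ->
    curve_at (points G) x (X x) cX -> curve_at (points G) x (Y x) cY ->
    tangent G x zeta ->
    metric G x (nabla x (X x) Y - nabla x (Y x) X) zeta =
    metric G x ('D_(1 : K) (fun t => Y (cX t)) (0 : K)
                - 'D_(1 : K) (fun t => X (cY t)) (0 : K)) zeta;
  lc_metric : forall x xi Y Z c, points G x -> tangent G x xi ->
    fields G Y -> fields G Z -> curve_at (points G) x xi c ->
    'D_(1 : K) (fun t => metric G (c t) (Y (c t)) (Z (c t))) (0 : K) =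
    metric G x (nabla x xi Y) (Z x) + metric G x (Y x) (nabla x xi Z)
}.

(* [f] is defined on an open neighbourhood of [x] in [E].  In the quotient case
   it is the lift of the function h to the total space, and 'd f x eta is the
   derivative of h along the tangent vector that eta lifts. *)
Definition rgrad (G : geometry) (f : E -> K) (x : E) : E :=
  xget 0 [set xi | tangent G x xi /\
    forall eta, tangent G x eta -> metric G x xi eta = 'd f x eta].

Definition rhess (G : geometry) (nabla : E -> E -> (E -> E) -> E)
  (f : E -> K) (x xi : E) : E := nabla x xi (rgrad G f).

Definition rhess_form (G : geometry) (nabla : E -> E -> (E -> E) -> E)
  (f : E -> K) (x xi eta : E) : K := metric G x (rhess G nabla f x xi) eta.

Definition is_basis (H : set E) (d : nat) (e : 'I_d -> E) : Prop :=
  (forall v, H v <-> exists a : 'I_d -> K, v = \sum_i a i *: e i) /\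
  (forall a : 'I_d -> K, \sum_i a i *: e i = 0 -> forall i, a i = 0).

(* The eigenvalues in [K] of a linear operator [T] of the subspace [H], with
   algebraic multiplicity and in nonincreasing order; [::] if the
   characteristic polynomial does not split over [K]. *)
Definition eigenvalues (H : set E) (T : E -> E) : seq K :=
  xget [::] [set s : seq K | sorted >=%R s /\
    exists d (e : 'I_d -> E) (A : 'M[K]_d),
      [/\ is_basis H e, forall i, T (e i) = \sum_j A i j *: e j
        & char_poly A = \prod_(l <- s) ('X - l%:P)]].

End Riemannian.

Arguments geometry {K} E.

(* Entries are counted from 1. *)
Definition entry {K : realType} (i : nat) (s : seq K) : K := nth 0 s i.-1.

Section Matrices.
Context {K : realType}.

Definition pos_def (r : nat) (A : 'M[K]_r) : Prop :=
  A^T = A /\ forall x : 'cV[K]_r, x != 0 -> 0 < (x^T *m A *m x) 0 0.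

Definition stiefel (r p : nat) : set 'M[K]_(p, r) :=
  [set U | U^T *m U = 1%:M].

(* n values for an m x n matrix: for m < n the list ends with extra zeros. *)
Definition singular_values (m n : nat) (A : 'M[K]_(m, n)) : seq K :=
  xget [::] [set s : seq K | [/\ sorted >=%R s, all (fun x => 0 <= x) s
    & char_poly (A^T *m A) = \prod_(x <- s) ('X - (x ^+ 2)%:P)]].

Definition sigma (i m n : nat) (A : 'M[K]_(m, n)) : K :=
  entry i (singular_values A).

(* Moore-Penrose inverse (the library's [pinvmx] is not it). *)
Definition mp_inverse (m n : nat) (A : 'M[K]_(m, n)) : 'M[K]_(n, m) :=
  xget 0 [set B | [/\ A *m B *m A = A, B *m A *m B = B,
    (A *m B)^T = A *m B & (B *m A)^T = B *m A]].

(* The columns of U and V span the left and right singular subspaces of X for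
   its r largest singular values: Ub and Vb hold singular vectors. *)
Definition top_singular_subspaces (p1 p2 r : nat) (X : 'M[K]_(p1, p2))
    (U : 'M[K]_(p1, r)) (V : 'M[K]_(p2, r)) : Prop :=
  exists (Ub : 'M[K]_(p1, r)) (Vb : 'M[K]_(p2, r)),
    let S := diag_mx (\row_(i < r) sigma i.+1 X) in
    [/\ stiefel Ub, stiefel Vb, X *m Vb = Ub *m S, X^T *m Ub = Vb *m S
      & (U^T == Ub^T)%MS /\ (V^T == Vb^T)%MS].

End Matrices.

Section Embedded.
Context {K : realType} (p1 p2 r : nat).

Definition fixed_rank : set 'M[K]_(p1, p2) := [set X | \rank X = r].

Definition embedded_geometry : geometry 'M[K]_(p1, p2) := {|
  points := fixed_rank;
  tangent := tangent_space fixed_rank;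
  metric := fun _ xi eta => \tr (xi^T *m eta);
  functions := Ck_on 1 fixed_rank;
  fields := [set Y | Ck_on 1 fixed_rank Y /\
    forall X, fixed_rank X -> tangent_space fixed_rank X (Y X)]
|}.

End Embedded.

Section Quotient.
Context {K : realType} (p1 p2 r : nat).

Local Notation total := ('M[K]_(p1, r) * 'M[K]_(p2, r))%type.

Definition total_space : set total :=
  [set x | \rank x.1 = r /\ \rank x.2 = r].

Definition act (x : total) (M : 'M[K]_r) : total :=
  (x.1 *m M, x.2 *m (invmx M)^T).

Definition fiber (x : total) : set total :=
  [set y | exists2 M, M \in unitmx & y = act x M].

Definition product (x : total) : 'M[K]_(p1, p2) := x.1 *m x.2^T.

Variables W V : total -> 'M[K]_r.

Definition weights : Prop :=
  [/\ forall k, Ck_on k total_space W, forall k, Ck_on k total_space V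
    & forall x, total_space x -> pos_def (W x) /\ pos_def (V x)].

Definition weights_invariant : Prop :=
  forall x M, total_space x -> M \in unitmx ->
    W x = M *m W (act x M) *m M^T /\
    V x = (invmx M)^T *m V (act x M) *m invmx M.

Definition total_metric (x eta theta : total) : K :=
  \tr (W x *m eta.1^T *m theta.1) + \tr (V x *m eta.2^T *m theta.2).

Definition horizontal (x : total) : set total :=
  [set theta | forall eta, tangent_space (fiber x) x eta ->
     total_metric x eta theta = 0].

(* The action is linear, leaves the quotient map unchanged and, for invariant
   weights, preserves horizontality.  Hence horizontal vectors [theta] at [x] and
   [theta'] at [act x M] lift the same tangent vector of the quotient iff
   [theta' = act theta M], and a horizontal field descends to the quotient iff
   it commutes with the action. *)
Definition quotient_geometry : geometry total := {|
  points := total_space;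
  tangent := horizontal;
  metric := total_metric;
  functions := [set phi | Ck_on 1 total_space phi /\
    forall x M, total_space x -> M \in unitmx -> phi (act x M) = phi x];
  fields := [set Y | [/\ Ck_on 1 total_space Y,
    forall x, total_space x -> horizontal x (Y x)
    & forall x M, total_space x -> M \in unitmx ->
        Y (act x M) = act (Y x) M]]
|}.

Definition lifted_objective (f : 'M[K]_(p1, p2) -> K) (x : total) : K := f (product x).

Definition tangent_map (x theta : total) : 'M[K]_(p1, p2) :=
  x.1 *m theta.2^T + theta.1 *m x.2^T.

Definition left_gram (U : 'M[K]_(p1, r)) (x : total) : 'M[K]_r :=
  let P1 := U^T *m x.1 in P1 *m invmx (V x) *m P1^T.

Definition right_gram (Vs : 'M[K]_(p2, r)) (x : total) : 'M[K]_r :=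
  let P2 := Vs^T *m x.2 in P2 *m invmx (W x) *m P2^T.

Definition gamma (U : 'M[K]_(p1, r)) (Vs : 'M[K]_(p2, r)) (x : total) : K :=
  Num.min (sigma r (right_gram Vs x)) (sigma r (left_gram U x)).

Definition Gamma (U : 'M[K]_(p1, r)) (Vs : 'M[K]_(p2, r)) (x : total) : K :=
  Num.max (sigma 1 (right_gram Vs x)) (sigma 1 (left_gram U x)).

Definition gamma_sup (U : 'M[K]_(p1, r)) (Vs : 'M[K]_(p2, r))
  (X : 'M[K]_(p1, p2)) : K :=
  sup [set gamma U Vs x | x in [set x | product x = X]].

Definition Gamma_inf (U : 'M[K]_(p1, r)) (Vs : 'M[K]_(p2, r))
  (X : 'M[K]_(p1, p2)) : K :=
  inf [set Gamma U Vs x | x in [set x | product x = X]].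

End Quotient.

Definition sandwiched {K : realType} (a b c : K) : Prop :=
  Num.min b c <= a <= Num.max b c.

(* Main.v *)
(* Write x = (L, R), X = L R^T and T for the differential of (L, R) |-> L R^T.
   The horizontal vectors at x are exactly the N(x) := (N R W^-1, N^T L V^-1) with
   N a p1 x p2 matrix; these satisfy g(N(x), eta) = <N, T eta>, so that
   grad h = (grad f)(x) in this notation.  For fixed N, the equivariant horizontal
   field y |-> N(y) is mapped by T to a tangent field of the fixed-rank matrices,
   and h and f have the same derivatives along these two fields.  Since the gradient
   vanishes at a stationary point, metric compatibility reduces both Hessians to
   the derivative of this common function along corresponding curves; they are
   symmetric there because the second derivatives of f are.

   Moreover |N(x)|^2 = <N, N A> + <N, B N> and T N(x) = N A + B N for the
   semidefinite matrices A = R W^-1 R^T and B = L V^-1 L^T, whose nonzero eigenvalues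
   are the singular values in gamma and Gamma.  This gives
   gamma |theta|^2 <= |T theta|^2 <= 2 Gamma |theta|^2, and since gamma and Gamma are
   constant on the fiber, Ostrowski's argument on the congruent forms Hess h and
   Hess f gives the sandwich inequalities. *)
Require Import Defs.
From HB Require Import structures.
From mathcomp Require Import all_boot all_order all_algebra fingroup perm.
From mathcomp Require Import all_classical all_reals all_analysis.
From mathcomp Require Import ring lra.

Set Implicit Arguments.
Unset Strict Implicit.
Unset Printing Implicit Defensive.

Import Order.TTheory GRing.Theory Num.Theory.
Import numFieldNormedType.Exports.

Local Open Scope classical_set_scope.
Local Open Scope ring_scope.

(** * Continuously differentiable maps *)

Section C1.
Context {K : realType}.
Implicit Types E F H : normedModType K.

(** The connections are known only through the Levi-Civita axioms, so a Hessian can be reached only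
    by applying an axiom to fields already shown to be C^1. This obstacle shapes most of the
    analysis. The gradient on the fixed-rank matrices and the image of a horizontal field are
    described through a factorization of the point; their C^1 extensions off the manifold come from
    the local section Y |-> (Y R, ((L^T Y R)^-1 L^T Y)^T) of the product map.

    At a critical point, metric compatibility for the pair (gradient, N-field) loses the term in
    which the connection differentiates the N-field. Symmetry is read off an explicit formula for
    Hess h and passes to Hess f because T maps the horizontal space onto the tangent space.

    The constants are asymmetric because <N A, B N> is a squared norm: the lower bound can drop this
    cross term, while the upper bound pays a factor 2 for it. *)

Definition C1_at E F (f : E -> F) (x : E) : Prop :=
  \forall y \near x, differentiable f y /\
    forall v, {for y, continuous ('D_v f)}.

Lemma C1_at_open E F (f : E -> F) (x : E) : C1_at f x ->
  exists O : set E, [/\ open O, O x & Ck 1 O f].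
Proof.
move=> fx; exists (interior [set y | differentiable f y /\
    forall v, {for y, continuous ('D_v f)}]).
split; [exact: open_interior|exact: fx|].
by split => [y|v y] /interior_subset []//.
Qed.

Lemma Ck_C1_at E F (f : E -> F) (O : set E) (x : E) :
  open O -> O x -> Ck 1 O f -> C1_at f x.
Proof.
move=> oO Ox [df cf]; rewrite /C1_at; near=> y.
have Oy : O y by near: y; exact: open_nbhs_nbhs.
by split; [exact: df|move=> v; exact: cf].
Unshelve. all: by end_near. Qed.

Lemma Ck_C1_atT E F (f : E -> F) (x : E) : Ck 1 setT f -> C1_at f x.
Proof. by apply: Ck_C1_at => //; exact: openT. Qed.

Lemma C1_at_diff E F (f : E -> F) x : C1_at f x -> differentiable f x.
Proof. by move/nbhs_singleton => []. Qed.

Lemma C1_at_cont E F (f : E -> F) x : C1_at f x -> {for x, continuous f}.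
Proof. by move/C1_at_diff/differentiable_continuous. Qed.

(** Continuity of ['D_v f] at a nearby point needs the formula on a whole neighbourhood of that
    point, which [near_join] extracts from the second hypothesis. *)
Lemma near_C1_at E F (f : E -> F) (D : E -> E -> F) x :
  (\forall y \near x, differentiable f y) ->
  (\forall y \near x, forall v, 'D_v f y = D v y) ->
  (\forall y \near x, forall v, {for y, continuous (D v)}) -> C1_at f x.
Proof.
move=> df /near_join eD cD; rewrite /C1_at; near=> y.
split; first by near: y.
move=> v; rewrite /prop_for /continuous_at.
have eDy : \forall z \near y, forall v, 'D_v f z = D v z by near: y.
rewrite (nbhs_singleton eDy).
have : {for y, continuous (D v)} by move: v; near: y.
apply: cvg_trans; apply: near_eq_cvg.
by apply: filterS eDy => z ->.
Unshelve. all: by end_near. Qed.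

Lemma C1_at_cst E F (c : F) (x : E) : C1_at (cst c : E -> F) x.
Proof.
apply: (@near_C1_at _ _ _ (fun _ => cst 0)); apply: nearW => y //.
  by move=> v; rewrite derive_cst.
by move=> v; exact: cst_continuous.
Qed.

Lemma C1_at_lin E F (f : {linear E -> F}) (x : E) : continuous f -> C1_at f x.
Proof.
move=> cf; have df y : differentiable f y by exact: linear_differentiable.
apply: (@near_C1_at _ _ _ (fun v => cst (f v))); apply: nearW => y //.
  by move=> v; rewrite deriveE// diff_lin.
by move=> v; exact: cst_continuous.
Qed.

Lemma C1_at_add E F (f g : E -> F) (x : E) :
  C1_at f x -> C1_at g x -> C1_at (fun y => f y + g y) x.
Proof.
move=> cf cg; apply: (@near_C1_at _ _ _ (fun v y => 'D_v f y + 'D_v g y));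
  apply: filterS2 cf cg => y [df cf] [dg cg].
- exact: differentiableD.
- by move=> v; rewrite deriveD//; exact: diff_derivable.
- by move=> v; apply: continuousD; [exact: cf|exact: cg].
Qed.

Lemma C1_at_linl E F H (l : {linear F -> H}) (f : E -> F) (x : E) :
  continuous l -> C1_at f x -> C1_at (fun y => l (f y)) x.
Proof.
move=> cl cf; have dl y : differentiable l y by exact: linear_differentiable.
apply: (@near_C1_at _ _ _ (fun v y => l ('D_v f y)));
  apply: filterS cf => y [df cf].
- exact: (@differentiable_comp _ _ _ _ f l).
- move=> v; rewrite deriveE; last exact: (@differentiable_comp _ _ _ _ f l).
  by rewrite (@diff_comp _ _ _ _ f l)// deriveE// diff_lin.
- by move=> v; apply: (@continuous_comp _ _ _ ('D_v f) l); [exact: cf|exact: cl].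
Qed.

Lemma C1_at_mul E (f g : E -> K) (x : E) :
  C1_at f x -> C1_at g x -> C1_at (fun y => f y * g y) x.
Proof.
move=> cf cg.
apply: (@near_C1_at _ _ _ (fun v y => f y *: 'D_v g y + g y *: 'D_v f y));
  apply: filterS2 cf cg => y [df cf] [dg cg].
- exact: differentiableM.
- by move=> v; rewrite deriveM//; exact: diff_derivable.
- move=> v; apply: continuousD.
    by apply: continuousZ; [exact: differentiable_continuous|exact: cg].
  by apply: continuousZ; [exact: differentiable_continuous|exact: cf].
Qed.

Lemma C1_at_inv E (f : E -> K) (x : E) :
  C1_at f x -> f x != 0 -> C1_at (fun y => (f y)^-1) x.
Proof.
move=> cf fx0.
have nf : \forall y \near x, f y != 0.
  exact: cvgr_neq0 (C1_at_cont cf) fx0.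
apply: (@near_C1_at _ _ _ (fun v y => - (f y) ^- 2 *: 'D_v f y));
  apply: filterS2 cf nf => y [df cf] fy0.
- exact: differentiableV.
- by move=> v; rewrite deriveE ?diffV ?deriveE//; exact: differentiableV.
- move=> v; apply: continuousZ; last exact: cf.
  apply: continuousN; apply: continuousV; first by rewrite expf_neq0.
  apply: (@continuous_comp _ _ _ f (fun z => z ^+ 2)); last exact: exprn_continuous.
  exact: differentiable_continuous.
Qed.

Lemma C1_at_sum E F (I : Type) (s : seq I) (P : pred I) (f : I -> E -> F) x :
  (forall i, P i -> C1_at (f i) x) ->
  C1_at (fun y => \sum_(i <- s | P i) f i y) x.
Proof.
move=> cf; elim: s => [|i s ih].
  rewrite [X in C1_at X _](_ : _ = cst 0); first exact: C1_at_cst.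
  by apply/funext => y; rewrite big_nil.
rewrite [X in C1_at X _](_ : _ = fun y =>
   (if P i then f i y else 0) + \sum_(i <- s | P i) f i y).
  apply: C1_at_add; last exact: ih.
  by case: (P i) (cf i) => [/(_ isT)//|_]; exact: C1_at_cst.
by apply/funext => y; rewrite big_cons; case: ifPn => //; rewrite add0r.
Qed.

Lemma C1_at_prod E (I : Type) (s : seq I) (P : pred I) (f : I -> E -> K) x :
  (forall i, P i -> C1_at (f i) x) ->
  C1_at (fun y => \prod_(i <- s | P i) f i y) x.
Proof.
move=> cf; elim: s => [|i s ih].
  rewrite [X in C1_at X _](_ : _ = cst 1); first exact: C1_at_cst.
  by apply/funext => y; rewrite big_nil.
rewrite [X in C1_at X _](_ : _ = fun y =>
   (if P i then f i y else 1) * \prod_(i <- s | P i) f i y).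
  apply: C1_at_mul; last exact: ih.
  by case: (P i) (cf i) => [/(_ isT)//|_]; exact: C1_at_cst.
by apply/funext => y; rewrite big_cons; case: ifPn => //; rewrite mul1r.
Qed.

Lemma C1_at_Zl E F (k : E -> K) (v : F) x : C1_at k x ->
  C1_at (fun y => k y *: v) x.
Proof.
move=> ck.
have sx_lin : linear ( *:%R ^~ v : K -> F).
  by move=> u y z; rewrite scalerDl scalerA.
pose sxlM := GRing.isLinear.Build _ _ _ _ _ sx_lin.
pose sxL : {linear _ -> _} := HB.pack ( *:%R ^~ v) sxlM.
by apply: (C1_at_linl (l := sxL)) => //; exact: scalel_continuous.
Qed.

(** Finite dimension in the form that the chain rule needs: [Ck] controls derivatives in fixed
    directions only, and a frame expands a moving direction into finitely many fixed ones with
    continuous coefficients. *)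
Definition has_frame F : Prop :=
  exists (I : finType) (phi : I -> {linear F -> K}) (e : I -> F),
    (forall i, continuous (phi i)) /\ forall v, v = \sum_i phi i v *: e i.

Lemma C1_at_comp E F H (f : F -> H) (g : E -> F) x : has_frame F ->
  C1_at g x -> C1_at f (g x) -> C1_at (fun y => f (g y)) x.
Proof.
move=> [I [phi [e [cphi ephi]]]] cg cf.
have {}cf : \forall y \near x, differentiable f (g y) /\
    forall v, {for g y, continuous ('D_v f)}.
  exact: (C1_at_cont cg) cf.
apply: (@near_C1_at _ _ _
  (fun v y => \sum_i phi i ('D_v g y) *: 'D_(e i) f (g y)));
  apply: filterS2 cf cg => y [df cf] [dg cg].
- exact: (@differentiable_comp _ _ _ _ g f).
- move=> v; rewrite deriveE; last exact: (@differentiable_comp _ _ _ _ g f).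
  rewrite (@diff_comp _ _ _ _ g f)//= {1}[X in 'd f _ X](ephi _) linear_sum.
  by apply: eq_bigr => i _; rewrite linearZ/= !deriveE.
- move=> v; rewrite /prop_for /continuous_at.
  apply: (@cvg_big _ _ +%R) => [|i _]; first exact: add_continuous.
  apply: cvgZ.
    by apply: (@continuous_comp _ _ _ ('D_v g) (phi i)); [exact: cg|exact: cphi].
  apply: (@continuous_comp _ _ _ g ('D_(e i) f)); last exact: cf.
  exact: differentiable_continuous.
Qed.

End C1.

(** * C^1 calculus for matrix-valued maps *)

Section C1_matrices.
Context {K : realType} {E : normedModType K}.
Implicit Types (m n p q : nat) (x y : E).

Definition coord_lin m n (i : 'I_m) (j : 'I_n) : {linear 'M[K]_(m, n) -> K} :=
  HB.pack (fun A : 'M[K]_(m, n) => A i j)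
    (GRing.isLinear.Build K 'M[K]_(m, n) K _ (fun A : 'M[K]_(m, n) => A i j)
      (fun a A B => eq_trans (mxE _ _ i j)
         (congr1 (fun z => z + B i j) (mxE _ _ i j)))).

Lemma coord_lin_continuous m n (i : 'I_m) (j : 'I_n) :
  continuous (coord_lin i j).
Proof. exact: coord_continuous. Qed.

Lemma C1_at_coord m n (f : E -> 'M[K]_(m, n)) i j x :
  C1_at f x -> C1_at (fun y => f y i j) x.
Proof. exact: (C1_at_linl (@coord_lin_continuous m n i j)). Qed.

Lemma C1_at_mx m n (f : E -> 'M[K]_(m, n)) x :
  (forall i j, C1_at (fun y => f y i j) x) -> C1_at f x.
Proof.
move=> cf; rewrite (_ : f = fun y =>
    \sum_i \sum_j f y i j *: delta_mx i j).
  by do 2![apply: C1_at_sum => ? _]; apply: C1_at_Zl; exact: cf.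
by apply/funext => y; rewrite {1}(matrix_sum_delta (f y)).
Qed.

Lemma C1_at_mulmx m n p (f : E -> 'M[K]_(m, n)) (g : E -> 'M[K]_(n, p)) x :
  C1_at f x -> C1_at g x -> C1_at (fun y => f y *m g y) x.
Proof.
move=> cf cg; apply: C1_at_mx => i j.
rewrite [X in C1_at X _](_ : _ = fun y => \sum_k f y i k * g y k j).
  by apply: C1_at_sum => k _; apply: C1_at_mul; exact: C1_at_coord.
by apply/funext => y; rewrite mxE.
Qed.

Lemma C1_at_trmx m n (f : E -> 'M[K]_(m, n)) x :
  C1_at f x -> C1_at (fun y => (f y)^T) x.
Proof.
move=> cf; apply: C1_at_mx => i j.
rewrite [X in C1_at X _](_ : _ = fun y => f y j i); first exact: C1_at_coord.
by apply/funext => y; rewrite mxE.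
Qed.

Lemma C1_at_opp (F : normedModType K) (f : E -> F) x :
  C1_at f x -> C1_at (fun y => - f y) x.
Proof. by apply: (C1_at_linl (l := -%R)); exact: opp_continuous. Qed.

Lemma C1_at_sub (F : normedModType K) (f g : E -> F) x :
  C1_at f x -> C1_at g x -> C1_at (fun y => f y - g y) x.
Proof. by move=> cf cg; apply: C1_at_add => //; exact: C1_at_opp. Qed.

Lemma C1_at_det n (f : E -> 'M[K]_n) x :
  C1_at f x -> C1_at (fun y => \det (f y)) x.
Proof.
move=> cf; apply: C1_at_sum => s _; apply: C1_at_mul; first exact: C1_at_cst.
by apply: C1_at_prod => i _; exact: C1_at_coord.
Qed.

Lemma C1_at_adjugate n (f : E -> 'M[K]_n) x :
  C1_at f x -> C1_at (fun y => \adj (f y)) x.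
Proof.
move=> cf; apply: C1_at_mx => i j.
rewrite [X in C1_at X _](_ : _ = fun y => cofactor (f y) j i); last first.
  by apply/funext => y; rewrite mxE.
apply: C1_at_mul; first exact: C1_at_cst.
apply: C1_at_det; apply: C1_at_mx => k l.
rewrite [X in C1_at X _](_ : _ = fun y => f y (lift j k) (lift i l)).
  exact: C1_at_coord.
by apply/funext => y; rewrite !mxE.
Qed.

(* [invmx A] is [A] for singular [A]; this version is smooth where it is used
   and agrees with [invmx] on invertible matrices. *)
Definition adj_inv n (A : 'M[K]_n) : 'M[K]_n := (\det A)^-1 *: \adj A.

Lemma adj_invE n (A : 'M[K]_n) : A \in unitmx -> adj_inv A = invmx A.
Proof. by move=> Au; rewrite /invmx Au. Qed.

Lemma C1_at_inv_mx n (f : E -> 'M[K]_n) x : f x \in unitmx ->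
  C1_at f x -> C1_at (fun y => adj_inv (f y)) x.
Proof.
rewrite unitmxE unitfE => fx0 cf; apply: C1_at_mx => i j.
rewrite [X in C1_at X _](_ : _ = fun y =>
  (\det (f y))^-1 * (\adj (f y)) i j); last by apply/funext => y; rewrite mxE.
apply: C1_at_mul; last exact/C1_at_coord/C1_at_adjugate.
by apply: C1_at_inv => //; exact: C1_at_det.
Qed.

End C1_matrices.

Lemma near_unitmx (K : realType) (E : normedModType K) n (f : E -> 'M[K]_n) x : {for x, continuous f} ->
  f x \in unitmx -> \forall y \near x, f y \in unitmx.
Proof.
move=> cf; rewrite unitmxE unitfE => fx0.
have cdet : {for x, continuous (fun y => \det (f y))}.
  apply: (@continuous_comp _ _ _ f (fun A => \det A)) => //.
  by apply: C1_at_cont; apply: (@C1_at_det _ _ _ id); by apply: (@C1_at_lin _ _ _ idfun) => A; exact: cvg_id.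
have nz : \forall y \near x, \det (f y) != 0 by exact: cvgr_neq0 cdet fx0.
by apply: filterS nz => y; rewrite unitmxE unitfE.
Qed.

Section Frames.
Context {K : realType}.

Lemma has_frame_mx m n : has_frame ('M[K]_(m, n)).
Proof.
exists ('I_m * 'I_n)%type, (fun ij => coord_lin ij.1 ij.2),
  (fun ij => delta_mx ij.1 ij.2); split.
  by move=> ij; exact: coord_lin_continuous.
move=> A; rewrite {1}(matrix_sum_delta A).
by rewrite pair_bigA.
Qed.

Context {E F : normedModType K}.

Definition fst_lin : {linear (E * F)%type -> E} :=
  HB.pack (fst : E * F -> E) (GRing.isLinear.Build K (E * F)%type E _ fst
    (fun a (u v : E * F) => erefl)).

Definition snd_lin : {linear (E * F)%type -> F} :=
  HB.pack (snd : E * F -> F) (GRing.isLinear.Build K (E * F)%type F _ snd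
    (fun a (u v : E * F) => erefl)).

Lemma inl_is_linear : linear (fun e : E => (e, 0 : F)).
Proof. by move=> a u v; congr pair; rewrite /= scaler0 addr0. Qed.

Definition inl_lin : {linear E -> (E * F)%type} :=
  HB.pack (fun e : E => (e, 0 : F))
   (GRing.isLinear.Build K E (E * F)%type _ _ inl_is_linear).

Lemma inr_is_linear : linear (fun e : F => (0 : E, e)).
Proof. by move=> a u v; congr pair; rewrite /= scaler0 addr0. Qed.

Definition inr_lin : {linear F -> (E * F)%type} :=
  HB.pack (fun e : F => (0 : E, e))
   (GRing.isLinear.Build K F (E * F)%type _ _ inr_is_linear).

Lemma fst_lin_continuous : continuous fst_lin.
Proof. by move=> [u v]; exact: cvg_fst. Qed.

Lemma snd_lin_continuous : continuous snd_lin.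
Proof. by move=> [u v]; exact: cvg_snd. Qed.

Lemma inl_lin_continuous : continuous inl_lin.
Proof. by move=> u; apply: cvg_pair; [exact: cvg_id|exact: cvg_cst]. Qed.

Lemma inr_lin_continuous : continuous inr_lin.
Proof. by move=> u; apply: cvg_pair; [exact: cvg_cst|exact: cvg_id]. Qed.

Lemma C1_at_fst (H : normedModType K) (f : H -> E * F) x :
  C1_at f x -> C1_at (fun y => (f y).1) x.
Proof. exact: (C1_at_linl fst_lin_continuous). Qed.

Lemma C1_at_snd (H : normedModType K) (f : H -> E * F) x :
  C1_at f x -> C1_at (fun y => (f y).2) x.
Proof. exact: (C1_at_linl snd_lin_continuous). Qed.

Lemma C1_at_pair (H : normedModType K) (f : H -> E) (g : H -> F) x :
  C1_at f x -> C1_at g x -> C1_at (fun y => (f y, g y)) x.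
Proof.
move=> cf cg; rewrite (_ : (fun y => _) = fun y => inl_lin (f y) + inr_lin (g y)).
  apply: C1_at_add; first exact: (C1_at_linl inl_lin_continuous).
  exact: (C1_at_linl inr_lin_continuous).
by apply/funext => y; congr pair; rewrite /= ?addr0 ?add0r.
Qed.

Lemma has_frame_pair : has_frame E -> has_frame F -> has_frame (E * F)%type.
Proof.
move=> [I [phi [e [cphi ephi]]]] [J [psi [f [cpsi epsi]]]].
exists (I + J)%type, (fun k => match k with
    | inl i => [the {linear _ -> _} of phi i \o fst_lin]
    | inr j => [the {linear _ -> _} of psi j \o snd_lin] end),
  (fun k => match k with inl i => inl_lin (e i) | inr j => inr_lin (f j) end).
split.
  move=> [i|j] u.
    by apply: continuous_comp; [exact: fst_lin_continuous|exact: cphi].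
  by apply: continuous_comp; [exact: snd_lin_continuous|exact: cpsi].
move=> [u v]; rewrite big_sumType/=.
rewrite [X in _ = X + _](_ : _ = inl_lin u); last first.
  by rewrite [in RHS](ephi u) linear_sum; apply: eq_bigr => i _; rewrite linearZ.
rewrite [X in _ = _ + X](_ : _ = inr_lin v); last first.
  by rewrite [in RHS](epsi v) linear_sum; apply: eq_bigr => i _; rewrite linearZ.
by congr pair; rewrite /= ?addr0 ?add0r.
Qed.

End Frames.

Section Ck_on1.
Context {K : realType} {E F : normedModType K}.

Lemma Ck_on1I (M : set E) (f : E -> F) :
  (forall x, M x -> exists2 g : E -> F, C1_at g x &
    \forall y \near x, M y -> f y = g y) -> Ck_on 1 M f.
Proof.
move=> H x Mx; have [g cgx fg] := H _ Mx.
have [B [oB Bx]] := C1_at_open cgx; case=> dg cg.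
exists (B `&` interior [set y | M y -> f y = g y]), g; split.
- by apply: openI => //; exact: open_interior.
- by [].
- by split=> [y [By _]|v y [By _]]; [exact: dg|exact: cg].
- by move=> y [_ /interior_subset].
Qed.

Lemma Ck_on1E (M : set E) (f : E -> F) x : Ck_on 1 M f -> M x ->
  exists2 g : E -> F, C1_at g x & \forall y \near x, M y -> f y = g y.
Proof.
move=> H /H [B [g [oB Bx cg fg]]]; exists g; first exact: Ck_C1_at cg.
by apply: filterS (open_nbhs_nbhs (conj oB Bx)) => y /fg.
Qed.

End Ck_on1.

(** * Directional derivatives of matrix expressions *)

Section Derivatives_matrices.
Context {K : realType} {E : normedModType K}.

Lemma is_derive_coord m n (A : E -> 'M[K]_(m, n)) x v dA i j :
  is_derive x v A dA -> is_derive x v (fun y => A y i j) (dA i j).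
Proof.
move=> [dAx <-]; apply: DeriveDef; first exact: ((derivable_mxP A x v).1 dAx i j).
by rewrite derive_mx// mxE.
Qed.

Lemma is_derive_mx m n (A : E -> 'M[K]_(m, n)) x v (dA : 'M[K]_(m, n)) :
  (forall i j, is_derive x v (fun y => A y i j) (dA i j)) ->
  is_derive x v A dA.
Proof.
move=> H.
have dAx : derivable A x v.
  by apply: (derivable_mxP A x v).2 => i j; case: (H i j).
apply: DeriveDef => //; rewrite derive_mx//; apply/matrixP => i j.
by rewrite mxE; case: (H i j).
Qed.

Lemma is_derive_mulmx m n p (A : E -> 'M[K]_(m, n)) (B : E -> 'M[K]_(n, p))
    x v dA dB :
  is_derive x v A dA -> is_derive x v B dB ->
  is_derive x v (fun y => A y *m B y) (dA *m B x + A x *m dB).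
Proof.
move=> hA hB; apply: is_derive_mx => i j.
rewrite (_ : (fun y => _) = \sum_k ((fun y => A y i k) * (fun y => B y k j))).
  have H k := is_deriveM (is_derive_coord i k hA) (is_derive_coord k j hB).
  apply: is_derive_eq; rewrite !mxE -big_split; apply: eq_bigr => k _ /=.
  by rewrite addrC; congr (_ + _); exact: mulrC.
by apply/funext => y; rewrite mxE fct_sumE.
Qed.

Lemma is_derive_trmx m n (A : E -> 'M[K]_(m, n)) x v dA :
  is_derive x v A dA -> is_derive x v (fun y => (A y)^T) dA^T.
Proof.
move=> hA; apply: is_derive_mx => i j; rewrite mxE.
rewrite (_ : (fun y => _) = fun y => A y j i); first exact: is_derive_coord.
by apply/funext => y; rewrite mxE.
Qed.

Lemma is_derive_mxtrace n (A : E -> 'M[K]_n) x v dA :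
  is_derive x v A dA -> is_derive x v (fun y => \tr (A y)) (\tr dA).
Proof.
move=> hA; rewrite (_ : (fun y => _) = \sum_k (fun y => A y k k)).
  have H k := is_derive_coord k k hA.
  by apply: is_derive_eq; apply: eq_bigr.
by apply/funext => y; rewrite fct_sumE.
Qed.

End Derivatives_matrices.

(** * Symmetry of second derivatives *)

Section Schwarz.
Context {K : realType} {E : normedModType K}.
Implicit Types (x y a b : E).

Lemma is_derive_line (F : normedModType K) (f : E -> F) y a (s : K) :
  differentiable f (y + s *: a) ->
  is_derive s (1 : K) (fun s => f (y + s *: a)) ('D_a f (y + s *: a)).
Proof.
move=> df.
have dl : is_derive s (1 : K) (fun s : K => y + s *: a) a.
  have ds : is_derive s (1 : K) ( *:%R^~ a : K -> E) a.
    have dsc : differentiable ( *:%R^~ a : K -> E) s by [].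
    apply: DeriveDef; first exact: diff_derivable.
    by rewrite deriveE// diff_val scale1r.
  have := is_deriveD (is_derive_cst y s (1 : K)) ds.
  by rewrite add0r.
have dl1 : differentiable (fun s : K => y + s *: a) s.
  exact/derivable1_diffP.
have e : 'd (fun s : K => y + s *: a) s 1 = a.
  by rewrite -deriveE// derive_val.
have dc : differentiable (f \o (fun s : K => y + s *: a)) s.
  exact: differentiable_comp.
apply: DeriveDef; first by apply: diff_derivable; exact: dc.
rewrite (@deriveE _ _ _ (f \o (fun s : K => y + s *: a)) s 1 dc).
by rewrite diff_comp//= e deriveE.
Qed.

(** Mean value theorem twice: in direction [a] on the increment of [f] along [b], then in direction
    [b] on ['D_a f]. The second difference is symmetric in [a] and [b], which is what makes the
    mixed derivatives agree in the limit. *)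
Lemma mixed_difference (f : E -> K) x a b (h : K) :
  Ck 2 setT f -> 0 < h -> exists s t : K,
  [/\ 0 < s < h, 0 < t < h &
    f (x + h *: a + h *: b) - f (x + h *: a) - f (x + h *: b) + f x =
    h ^+ 2 * 'D_b ('D_a f) (x + s *: a + t *: b)].
Proof.
move=> [df cf] h0.
have dfl y c s : is_derive s (1 : K) (fun s => f (y + s *: c))
    ('D_c f (y + s *: c)) by apply: is_derive_line; exact: df.
have dDfl y c s : is_derive s (1 : K) (fun s => 'D_a f (y + s *: c))
    ('D_c ('D_a f) (y + s *: c)).
  by apply: is_derive_line; apply: (cf a).1.
pose phi (s : K) := f ((x + h *: b) + s *: a) - f (x + s *: a).
have dphi s : is_derive s (1 : K) phi
    ('D_a f ((x + h *: b) + s *: a) - 'D_a f (x + s *: a)).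
  exact: is_deriveB.
have cphi : {within `[0, h], continuous phi}.
  by apply: derivable_within_continuous => s _; case: (dphi s).
have [s sh Hs] := MVT h0 (fun s _ => dphi s) cphi.
pose psi (t : K) := 'D_a f ((x + s *: a) + t *: b).
have cpsi : {within `[0, h], continuous psi}.
  by apply: derivable_within_continuous => t _; case: (dDfl (x + s *: a) b t).
have [t th Ht] := MVT h0 (fun t _ => dDfl (x + s *: a) b t) cpsi.
exists s, t; split; first by move: sh; rewrite in_itv.
  by move: th; rewrite in_itv.
move: Hs Ht; rewrite /phi /psi !scale0r !addr0 !subr0.
rewrite -!addrA ![h *: b + _]addrC ![s *: a + h *: b]addrC => Hs Ht.
rewrite opprD opprK in Hs; rewrite Hs Ht expr2.
by rewrite [RHS]mulrC mulrA.
Qed.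

(** The intermediate points for the two orders of differentiation differ, so values are compared at
    two distinct points that both tend to [x]. *)
Lemma continuous_eq_values (g1 g2 : E -> K) x :
  {for x, continuous g1} -> {for x, continuous g2} ->
  (forall d : K, 0 < d -> exists y1 y2 : E,
    [/\ ball x d y1, ball x d y2 & g1 y1 = g2 y2]) -> g1 x = g2 x.
Proof.
move=> c1 c2 H; apply/eqP; rewrite -subr_eq0 -normr_le0; apply/ler_addgt0Pl => e e0.
rewrite addr0.
have e2 : 0 < e / 2 by rewrite divr_gt0.
have n1 : \forall y \near x, `|g1 x - g1 y| < e / 2.
  by move/cvgrPdist_lt : c1; exact.
have n2 : \forall y \near x, `|g2 x - g2 y| < e / 2.
  by move/cvgrPdist_lt : c2; exact.
have /nbhs_ballP[d /= d0 Hd] : \forall y \near x,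
   `|g1 x - g1 y| < e / 2 /\ `|g2 x - g2 y| < e / 2 by exact: filterI.
have [y1 [y2 [/Hd [B1 _] /Hd [_ B2] E12]]] := H d d0.
rewrite (le_trans (ler_distD (g1 y1) _ _))//.
rewrite [e]splitr lerD//; first exact: ltW.
by rewrite E12 distrC ltW.
Qed.

Lemma ball_add2 x u v (d h s t : K) : 0 < h -> h * (`|u| + `|v|) < d ->
  0 < s < h -> 0 < t < h -> ball x d (x + s *: u + t *: v).
Proof.
move=> h0 hd /andP[s0 sh] /andP[t0 th]; rewrite -ball_normE/=.
rewrite -addrA opprD addrA subrr add0r normrN.
apply: le_lt_trans (ler_normD _ _) _; apply: le_lt_trans hd.
rewrite !normrZ !gtr0_norm// mulrDr.
by apply: lerD; apply: ler_wpM2r => //; exact: ltW.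
Qed.

Lemma second_derivative_sym (f : E -> K) x a b : Ck 2 setT f ->
  'D_b ('D_a f) x = 'D_a ('D_b f) x.
Proof.
move=> Cf; have c1 v w : {for x, continuous ('D_w ('D_v f))}.
  exact: (Cf.2 v).2.
apply: (continuous_eq_values (c1 a b) (c1 b a)) => d d0.
have n0 : 0 <= `|a| + `|b| :> K by exact: addr_ge0.
have M0 : 0 < `|a| + `|b| + 1 :> K by exact: ltr_wpDl.
(* This side length keeps both intermediate points in the ball of radius [d]; the 1 covers the case
   where [a] and [b] vanish. *)
pose h : K := d / (`|a| + `|b| + 1).
have h0 : 0 < h by exact: divr_gt0.
have hd : h * (`|a| + `|b|) < d.
  by rewrite /h -mulrA gtr_pMr// ltr_pdivrMl// mulr1 ltrDl.
have [s [t [sh th E1]]] := mixed_difference x a b Cf h0.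
have [s' [t' [sh' th' E2]]] := mixed_difference x b a Cf h0.
exists (x + s *: a + t *: b), (x + s' *: b + t' *: a); split.
- exact: ball_add2 hd _ _.
- by apply: (ball_add2 _ h0) => //; rewrite [X in _ * X]addrC.
apply: (mulfI (_ : h ^+ 2 != 0)); first by rewrite expf_neq0// gt_eqF.
rewrite -E1 -E2 (addrAC x (h *: b)); congr (_ + _).
by rewrite -!addrA; congr (_ + _); exact: addrC.
Qed.

End Schwarz.

(** * Spectral theory of symmetric matrices *)

Section Spectral.
Context {K : realType}.

Definition qform n (A : 'M[K]_n) (u : 'rV[K]_n) : K := (u *m A *m u^T) 0 0.

Lemma dot_rV n (u v : 'rV[K]_n) : (u *m v^T) 0 0 = \sum_i u 0 i * v 0 i.
Proof. by rewrite mxE; apply: eq_bigr => i _; rewrite mxE. Qed.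

Lemma sqr_rV_ge0 n (u : 'rV[K]_n) : 0 <= (u *m u^T) 0 0.
Proof. by rewrite dot_rV sumr_ge0// => i _; rewrite -expr2 sqr_ge0. Qed.

Lemma sqr_rV_eq0 n (u : 'rV[K]_n) : ((u *m u^T) 0 0 == 0) = (u == 0).
Proof.
apply/eqP/eqP => [|->]; last by rewrite mul0mx mxE.
rewrite dot_rV => /psumr_eq0P H; apply/rowP => i; rewrite mxE.
by apply/eqP; rewrite -sqrf_eq0 expr2; apply/eqP/H => // j _; rewrite -expr2 sqr_ge0.
Qed.

Lemma qform_line n (A : 'M[K]_n) (u v : 'rV[K]_n) (t : K) : A^T = A ->
  qform A (u + t *: v) =
    qform A u + t * 2 * (v *m A *m u^T) 0 0 + t ^+ 2 * qform A v.
Proof.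
move=> sA; rewrite /qform linearD linearZ/= !mulmxDl !mulmxDr -!scalemxAl -!scalemxAr.
have -> : u *m A *m v^T = (v *m A *m u^T)^T.
  by rewrite !trmx_mul trmxK sA mulmxA.
by rewrite !mxE; ring.
Qed.

(** If [u *m A] were nonzero, moving from [u] against it would make the form negative at first
    order. *)
Lemma psd_null n (A : 'M[K]_n) (u : 'rV[K]_n) : A^T = A ->
  (forall v, 0 <= qform A v) -> qform A u = 0 -> u *m A = 0.
Proof.
move=> sA pA u0; apply/eqP; rewrite -sqr_rV_eq0.
set v := u *m A; set c := (_ 0 0).
have cE : (v *m A *m u^T) 0 0 = c.
  by rewrite /c /v [in RHS]trmx_mul sA mulmxA.
set w := qform A v.
have w0 : 0 <= w by exact: pA.
have w1 : 0 < w + 1 by rewrite ltr_wpDl.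
have w2 : 0 < w + 2 by rewrite ltr_wpDl.
apply/negP => /negP c0.
have c2 : 0 < c ^+ 2 by rewrite exprn_even_gt0.
(* The optimal step is c / w; [w + 1] keeps the denominator positive when [w] is 0. *)
have := pA (u + (- c / (w + 1)) *: v).
rewrite qform_line// u0 add0r cE -/w.
suff -> : - c / (w + 1) * 2 * c + (- c / (w + 1)) ^+ 2 * w
    = - (c ^+ 2 * (w + 2) / (w + 1) ^+ 2).
  by rewrite oppr_ge0 leNgt => /negP; apply; apply: divr_gt0; [exact: mulr_gt0|exact: exprn_gt0].
by field; rewrite gt_eqF.
Qed.

Lemma qform_continuous n (A : 'M[K]_n) : continuous (qform A).
Proof.
move=> u; apply: C1_at_cont; apply: (@C1_at_coord K 'rV[K]_n _ _ _ 0 0).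
have cid : C1_at (id : 'rV[K]_n -> 'rV[K]_n) u.
  by apply: (@C1_at_lin _ _ _ idfun) => x; exact: cvg_id.
apply: C1_at_mulmx; last exact: C1_at_trmx.
by apply: C1_at_mulmx => //; exact: C1_at_cst.
Qed.

(** Let [q] maximize the form on the unit sphere, with maximum l. Then l I - A is positive
    semidefinite and vanishes as a form at [q], so [psd_null] puts [q] in its kernel. *)
Lemma sym_eigenvector n (A : 'M[K]_n.+1) : A^T = A ->
  exists (q : 'rV[K]_n.+1) (l : K), q *m q^T = 1%:M /\ q *m A = l *: q.
Proof.
move=> sA; pose S := [set u : 'rV[K]_n.+1 | qform 1%:M u = 1].
have S0 : S !=set0.
  exists (delta_mx 0 0); rewrite /S/= /qform mulmx1 trmx_delta mul_delta_mx.
  by rewrite mxE !eqxx.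
have bS : bounded_set S.
  exists 1; split => // M M1 u; rewrite /S/= /qform mulmx1 dot_rV => u1.
  rewrite /Num.norm/= mx_normrE; apply: bigmax_le; first exact: ltW (lt_trans _ M1).
  move=> [i j] _ /=; rewrite ord1; apply: le_trans (ltW M1).
  rewrite -(@ler_pXn2r _ 2)// ?nnegrE// expr1n -normrX ger0_norm ?sqr_ge0//.
  rewrite -u1 (bigD1 j)//= expr2 lerDl sumr_ge0// => k _.
  by rewrite -expr2 sqr_ge0.
have clS : closed S.
  rewrite (_ : S = qform 1%:M @^-1` [set 1])//.
  apply: preimage_closed; last exact: closed_eq.
  by move=> x _; exact: qform_continuous.
have [q qS qmax] := EVT_max_rV S0 (bounded_closed_compact bS clS)
  (continuous_subspaceT (@qform_continuous _ A)).
move: qS; rewrite inE /S/= => qS.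
exists q, (qform A q); split.
  by rewrite [LHS]mx11_scalar; congr (_%:M); move: qS; rewrite /qform mulmx1.
pose B := (qform A q)%:M - A.
have qB v : qform B v = qform A q * qform 1%:M v - qform A v.
  rewrite /qform /B mulmxBr mulmxBl mulmx1 mul_mx_scalar -scalemxAl.
  by rewrite [LHS]mxE [X in X + _]mxE [X in _ + X]mxE.
have sB : B^T = B by rewrite /B linearB/= tr_scalar_mx sA.
have pB v : 0 <= qform B v.
  have [->|v0] := eqVneq v 0.
    by rewrite /qform !mul0mx mxE.
  have vv : 0 < qform 1%:M v.
    by rewrite /qform mulmx1 lt0r sqr_rV_eq0 v0 sqr_rV_ge0.
  pose s := Num.sqrt (qform 1%:M v).
  have s0 : 0 < s by rewrite sqrtr_gt0.
  have ss : s ^+ 2 = qform 1%:M v by rewrite sqr_sqrtr// ltW.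
  have sc C : qform C (s^-1 *: v) = (s ^+ 2)^-1 * qform C v.
    rewrite /qform linearZ/= -!scalemxAl -scalemxAr !scalerA mxE.
    by rewrite -expr2 exprVn.
  have vS : s^-1 *: v \in S by rewrite inE /S/= sc ss mulVf// gt_eqF.
  have := qmax _ vS; rewrite sc ss qB ler_pdivrMl// => H.
  by rewrite subr_ge0 mulrC.
have /(psd_null sB pB) : qform B q = 0 by rewrite qB qS mulr1 subrr.
by rewrite /B mulmxBr mul_mx_scalar => /eqP; rewrite subr_eq0 => /eqP ->.
Qed.

Lemma orthogonal_completion n (q : 'rV[K]_n.+1) : q *m q^T = 1%:M ->
  exists2 H : 'M[K]_n.+1, H *m H^T = 1%:M & row 0 H = q.
Proof.
move=> qq; pose w : 'rV[K]_n.+1 := delta_mx 0 0 - q.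
have [/eqP|w0] := eqVneq w 0.
  rewrite subr_eq0 => /eqP e; exists 1%:M; first by rewrite trmx1 mulmx1.
  by rewrite -e rowE mulmx1.
pose c := (w *m w^T) 0 0.
have c0 : c != 0 by rewrite sqr_rV_eq0.
have ww : w *m w^T = c%:M by rewrite [LHS]mx11_scalar.
(* Householder reflection exchanging the first basis vector and [q] *)
pose H := 1%:M - (2 / c) *: (w^T *m w).
have sH : H^T = H.
  by rewrite /H linearB/= trmx1 linearZ/= trmx_mul trmxK.
exists H.
  pose k := 2 / c; pose P := w^T *m w.
  have PP : P *m P = c *: P.
    by rewrite /P mulmxA -(mulmxA _ w) ww mul_mx_scalar -scalemxAl.
  have kc : k * c = 2 by rewrite /k divfK.
  rewrite sH /H -/k -/P mulmxBl mul1mx mulmxBr mulmx1 -scalemxAl -scalemxAr PP.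
  rewrite !scalerA -mulrA kc -scalerBl -addrA -opprD -scalerDl.
  have -> : k + (k - k * 2) = 0 by ring.
  by rewrite scale0r subr0.
rewrite rowE /H mulmxBr mulmx1 -scalemxAr mulmxA.
(* For unit vectors, |e - q|^2 = 2 (1 - <e, q>) = 2 <e, e - q>. *)
have -> : delta_mx 0 0 *m w^T = (c / 2)%:M.
  pose e : 'rV[K]_n.+1 := delta_mx 0 0; rewrite -/e.
  have ee : e *m e^T = 1%:M.
    by rewrite trmx_delta mul_delta_mx [LHS]mx11_scalar mxE !eqxx.
  have qe : q *m e^T = e *m q^T.
    by rewrite -[LHS]trmxK trmx_mul trmxK [LHS]mx11_scalar
               [RHS]mx11_scalar mxE.
  have cE : c = 2 * (1 - (e *m q^T) 0 0).
    rewrite /c /w -/e linearB/= mulmxBl !mulmxBr ee qq qe.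
    by rewrite !mxE eqxx/=; ring.
  rewrite cE mulrC mulKf ?pnatr_eq0// /w -/e linearB/= mulmxBr ee.
  by rewrite [LHS]mx11_scalar; congr (_%:M); rewrite !mxE eqxx.
rewrite mul_scalar_mx scalerA mulrA divfK// mulfV// ?pnatr_eq0//.
by rewrite scale1r /w opprB addrC subrK.
Qed.

(** Deflation: in an orthonormal basis that starts with an eigenvector, symmetry clears the rest of
    the first row and column, and induction treats the remaining block. *)
Lemma sym_diagonalization n (A : 'M[K]_n) : A^T = A ->
  exists (Q : 'M[K]_n) (d : 'rV[K]_n), Q *m Q^T = 1%:M /\ Q *m A *m Q^T = diag_mx d.
Proof.
elim: n A => [|n IHn] A sA.
  by exists 1%:M, 0; split; apply/matrixP => -[].
have [q [l [qq qA]]] := sym_eigenvector sA.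
have [H HH rH] := orthogonal_completion qq.
have [B BE] : exists B, B = H *m A *m H^T by exists (H *m A *m H^T).
have sB : B^T = B by rewrite BE !trmx_mul trmxK sA mulmxA.
have rB : row 0 B = l *: delta_mx 0 0.
  rewrite BE !row_mul rH qA -scalemxAl -rH -row_mul HH.
  by rewrite rowE mulmx1.
have B0j j : B 0 j = l *+ (j == 0).
  by have /rowP/(_ j) := rB; rewrite !mxE eqxx/= mulr_natr.
pose B' : 'M[K]_(1 + n) := B.
pose C := drsubmx B'.
have sC : C^T = C by rewrite /C trmx_drsub sB.
have eB : B' = block_mx l%:M 0 0 C.
  rewrite -[LHS]submxK; congr block_mx.
  - apply/matrixP => i j; rewrite !ord1 !mxE eqxx.
    by rewrite (_ : lshift n 0 = 0) ?B0j//; exact/val_inj.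
  - apply/matrixP => i j; rewrite !ord1 !mxE.
    by rewrite (_ : lshift n 0 = 0) ?B0j//; exact/val_inj.
  - apply/matrixP => i j; rewrite !ord1 !mxE -[B' _ _]/(B _ _) -sB mxE.
    by rewrite (_ : lshift n 0 = 0) ?B0j//; exact/val_inj.
have [Q [d [QQ QC]]] := IHn C sC.
pose Q1 : 'M[K]_(1 + n) := block_mx 1%:M 0 0 Q.
have Q1Q1 : Q1 *m Q1^T = 1%:M.
  rewrite /Q1 tr_block_mx mulmx_block !trmx0 !mulmx0 !mul0mx !addr0 add0r trmx1.
  by rewrite mulmx1 QQ -scalar_mx_block.
have key : Q1 *m B' *m Q1^T = diag_mx (row_mx (l%:M : 'M[K]_1) d).
  rewrite eB /Q1 tr_block_mx !mulmx_block !trmx0 !mulmx0 !mul0mx !addr0 !add0r.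
  rewrite trmx1 !mul1mx !mulmx1 ?mulmx0 ?mul0mx QC diag_mx_row.
  by congr block_mx; rewrite [RHS]mx11_scalar !mxE !eqxx !mulr1n.
exists (Q1 *m H), (row_mx (l%:M : 'M[K]_1) d); split.
  by rewrite trmx_mul mulmxA -(mulmxA Q1) HH mulmx1.
by rewrite trmx_mul !mulmxA -(mulmxA Q1 H) -(mulmxA Q1 _ H^T) -BE.
Qed.

Lemma spectral_theorem n (A : 'M[K]_n) : A^T = A ->
  exists (Q : 'M[K]_n) (d : 'rV[K]_n), [/\ Q *m Q^T = 1%:M,
    Q *m A *m Q^T = diag_mx d & forall i j : 'I_n, (i <= j)%N -> d 0 j <= d 0 i].
Proof.
move=> /sym_diagonalization [Q [d [QQ QA]]].
pose t := [tuple d 0 i | i < n]; pose s := sort >=%R t.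
have /tuple_permP[p ep] : perm_eq s t by rewrite perm_sort.
have so : sorted >=%R s by apply: sort_sorted; exact: ge_total.
pose P := perm_mx p : 'M[K]_n.
have PP : P *m P^T = 1%:M by rewrite /P tr_perm_mx -perm_mxM mulgV perm_mx1.
exists (P *m Q), (\row_i d 0 (p i)); split.
- by rewrite trmx_mul mulmxA -(mulmxA P) QQ mulmx1.
- rewrite trmx_mul !mulmxA -(mulmxA P Q) -(mulmxA P _ Q^T) QA.
  rewrite /P tr_perm_mx -row_permE -col_permE.
  apply/matrixP => i j; rewrite !mxE.
  by rewrite (inj_eq perm_inj).
- move=> i j ij; rewrite !mxE.
  have nE (k : 'I_n) : nth 0 s k = d 0 (p k).
    by rewrite ep (nth_mktuple _ 0 k) tnth_mktuple.
  have sz : size s = n by rewrite size_sort size_tuple.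
  rewrite -!nE; apply: (sorted_leq_nth ge_trans lexx 0 so) => //.
    by rewrite inE sz.
  by rewrite inE sz.
Qed.

End Spectral.

(** * Characteristic polynomials and singular values *)

Section Matrix_spectra.
Context {K : realType}.

Lemma char_poly_conj n (A P P' : 'M[K]_n) : P *m P' = 1%:M ->
  char_poly (P *m A *m P') = char_poly A.
Proof.
move=> PP; rewrite /char_poly /char_poly_mx.
have PP' : map_mx polyC P *m map_mx polyC P' = 1%:M :> 'M[{poly K}]_n.
  by rewrite -map_mxM PP map_mx1.
have -> : 'X%:M - map_mx polyC (P *m A *m P') =
   map_mx polyC P *m ('X%:M - map_mx polyC A) *m map_mx polyC P'.
  rewrite !map_mxM mulmxBr mulmxBl; congr (_ - _).
  by rewrite mul_mx_scalar -scalemxAl PP' scalemx1.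
by rewrite !det_mulmx mulrAC -det_mulmx PP' det1 mul1r.
Qed.

Lemma char_poly_diag n (d : 'rV[K]_n) :
  char_poly (diag_mx d) = \prod_i ('X - (d 0 i)%:P).
Proof.
rewrite char_poly_trig; last exact/diag_mx_is_trig.
by apply: eq_bigr => i _; rewrite mxE eqxx.
Qed.

Lemma char_poly_orthogonal n (A Q : 'M[K]_n) (d : 'rV[K]_n) : Q *m Q^T = 1%:M ->
  Q *m A *m Q^T = diag_mx d -> char_poly A = \prod_i ('X - (d 0 i)%:P).
Proof. by move=> QQ QA; rewrite -char_poly_diag -QA char_poly_conj. Qed.

Lemma sorted_prod_XsubC_inj (s t : seq K) : sorted >=%R s -> sorted >=%R t ->
  \prod_(x <- s) ('X - x%:P) = \prod_(x <- t) ('X - x%:P) -> s = t.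
Proof.
by move=> ss st /prod_XsubC_eq; exact: (sorted_eq ge_trans ge_anti).
Qed.

(** Squaring is monotone and injective on nonnegative numbers, so the sorted roots of the
    characteristic polynomial determine the list that [xget] picks. *)
Lemma singular_valuesE m n (A : 'M[K]_(m, n)) (s : seq K) :
  sorted >=%R s -> all (fun x => 0 <= x) s ->
  char_poly (A^T *m A) = \prod_(x <- s) ('X - (x ^+ 2)%:P) ->
  singular_values A = s.
Proof.
have sq (t : seq K) : sorted >=%R t -> all (fun x => 0 <= x) t ->
    sorted >=%R [seq x ^+ 2 | x <- t].
  move=> st t0; apply: (homo_sorted_in (P := fun x : K => 0 <= x)) st => //.
  by move=> x y x0 y0 /= yx; rewrite ler_pXn2r.
have sqK (t : seq K) : all (fun x => 0 <= x) t ->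
    [seq Num.sqrt x | x <- [seq x ^+ 2 | x <- t]] = t.
  move=> /allP t0; rewrite -map_comp -[RHS]map_id; apply/eq_in_map => x xt /=.
  by rewrite sqrtr_sqr ger0_norm// t0.
move=> ss s0 cs; apply: xget_unique => // t [st t0 ct].
rewrite -(sqK _ t0) -(sqK _ s0); congr map.
apply: sorted_prod_XsubC_inj; [exact: sq|exact: sq|].
by rewrite !big_map -cs -ct.
Qed.

Lemma nth_enum_rV n (d : 'rV[K]_n) (i : 'I_n) :
  nth 0 [seq d 0 i | i <- enum 'I_n] i = d 0 i.
Proof. by rewrite (nth_map i) ?size_enum_ord// nth_ord_enum. Qed.

Lemma sorted_enum_rV n (d : 'rV[K]_n) :
  (forall i j : 'I_n, (i <= j)%N -> d 0 j <= d 0 i) ->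
  sorted >=%R [seq d 0 i | i <- enum 'I_n].
Proof.
move=> H; apply/(sortedP 0) => i; rewrite size_map size_enum_ord => ilt.
have i' : (i < n)%N by exact: ltn_trans ilt.
have /= -> := nth_enum_rV d (Ordinal i'); have /= -> := nth_enum_rV d (Ordinal ilt).
by apply: H => /=.
Qed.

Lemma sigmaE m n (A : 'M[K]_(m, n)) (d : 'rV[K]_n) (i : 'I_n) :
  (forall i j : 'I_n, (i <= j)%N -> d 0 j <= d 0 i) -> (forall i, 0 <= d 0 i) ->
  char_poly (A^T *m A) = \prod_i ('X - (d 0 i ^+ 2)%:P) ->
  sigma i.+1 A = d 0 i.
Proof.
move=> sd d0 cA; rewrite /sigma /entry/=.
rewrite (@singular_valuesE _ _ _ [seq d 0 i | i <- enum 'I_n]).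
- exact: nth_enum_rV.
- exact: sorted_enum_rV.
- by apply/allP => _ /mapP[j _ ->].
- by rewrite big_map cA big_enum.
Qed.

(** Row by row, u A^T A u^T is the squared norm of u A^T. *)
Lemma gram_null m n p (A : 'M[K]_(m, n)) (u : 'M[K]_(p, n)) :
  u *m A^T *m A = 0 -> u *m A^T = 0.
Proof.
move=> uA; apply/row_matrixP => i; rewrite row0.
apply/eqP; rewrite -sqr_rV_eq0; pose z := row i (u *m A^T).
have : z *m A = 0 by rewrite -row_mul uA row0.
move=> /(congr1 (fun v => v *m (row i u)^T)).
rewrite mul0mx -mulmxA -{1}[A]trmxK -trmx_mul -[row i u *m _]row_mul => ->.
by rewrite mxE.
Qed.

Lemma gram_unit m n (A : 'M[K]_(m, n)) : \rank A = n -> A^T *m A \in unitmx.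
Proof.
move=> rA; rewrite -row_free_unit -kermx_eq0; apply/eqP.
have : kermx (A^T *m A) *m A^T = 0.
  by apply: gram_null; rewrite -mulmxA mulmx_ker.
have fA : row_free A^T by rewrite /row_free mxrank_tr rA.
by move=> H; apply: (row_free_inj fA); rewrite H mul0mx.
Qed.

Lemma gram_rank m n (A : 'M[K]_(m, n)) : \rank (A^T *m A) = \rank A.
Proof.
have H : (kermx (A^T *m A) <= kermx A^T)%MS.
  by apply/sub_kermxP/gram_null; rewrite -mulmxA mulmx_ker.
have := mxrankS H; rewrite !mxrank_ker mxrank_tr => le_r.
apply/eqP; rewrite eqn_leq mxrankM_maxr/=.
by move: le_r; rewrite leq_sub2lE// rank_leq_col.
Qed.

End Matrix_spectra.

Section Singular.
Context {K : realType}.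

(** The eigenvalues of A^T A are sorted and nonnegative. If the one of index [i], counted from 0,
    were zero, so would be all later ones, and the rank would be at most [i]. *)
Lemma sigma_gt0 m n (A : 'M[K]_(m, n)) i : (i < \rank A)%N -> 0 < sigma i.+1 A.
Proof.
move=> iA; have sG : (A^T *m A)^T = A^T *m A by rewrite trmx_mul trmxK.
have [Q [d [QQ QG sd]]] := spectral_theorem sG.
have d0 j : 0 <= d 0 j.
  have -> : d 0 j = (row j (Q *m A^T) *m (row j (Q *m A^T))^T) 0 0.
    have /matrixP/(_ j j) := QG; rewrite [RHS]mxE eqxx mulr1n => <-.
    have -> : Q *m (A^T *m A) *m Q^T = (Q *m A^T) *m (Q *m A^T)^T.
      by rewrite trmx_mul trmxK !mulmxA.
    by rewrite mxE dot_rV; apply: eq_bigr => k _; rewrite [(_^T) _ _]mxE !(mxE _ _ 0).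
  exact: sqr_rV_ge0.
have lt_in : (i < n)%N by rewrite (leq_trans iA)// rank_leq_col.
pose s : 'rV[K]_n := \row_j Num.sqrt (d 0 j).
have -> : sigma i.+1 A = s 0 (Ordinal lt_in).
  apply: (@sigmaE _ _ _ A s (Ordinal lt_in)).
  - by move=> a b ab; rewrite !mxE ler_sqrt// sd.
  - by move=> a; rewrite mxE sqrtr_ge0.
  - rewrite (char_poly_orthogonal QQ QG); apply: eq_bigr => j _.
    by rewrite mxE sqr_sqrtr.
rewrite mxE sqrtr_gt0 lt0r d0 andbT; apply/eqP => di.
have rd : \rank (diag_mx d) = \rank A.
  have Qu : Q \in unitmx by case: (mulmx1_unit QQ).
  rewrite -QG mxrankMfree; last by rewrite row_free_unit unitmx_tr.
  by rewrite eqmxMfull ?row_full_unit// gram_rank.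
have : (\rank (diag_mx d) <= i)%N.
  have -> : diag_mx d = diag_mx d *m (pid_mx i : 'M[K]_n).
    rewrite mul_diag_mx; apply/matrixP => a b; rewrite !mxE -val_eqE.
    case: eqP => [_|_] /=; last by rewrite mulr0n mulr0.
    rewrite mulr1n; case: ltnP => [_|ia]; first by rewrite mulr1.
    rewrite mulr0; apply/eqP; rewrite eq_le d0 andbT -di.
    by apply: sd.
  rewrite (leq_trans (mxrankM_maxr _ _))// rank_pid_mx//; exact: ltnW.
by rewrite rd leqNgt iA.
Qed.

(** Here A^T A = A^2, so the singular values are the eigenvalues themselves. *)
Lemma pos_def_spectral n (A : 'M[K]_n) : pos_def A ->
  exists (Q : 'M[K]_n) (d : 'rV[K]_n), [/\ Q *m Q^T = 1%:M,
    A = Q^T *m diag_mx d *m Q, forall i, 0 < d 0 i,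
    forall i j : 'I_n, (i <= j)%N -> d 0 j <= d 0 i &
    forall i : 'I_n, sigma i.+1 A = d 0 i].
Proof.
move=> [sA pA]; have [Q [d [QQ QA sd]]] := spectral_theorem sA.
have QQ' : Q^T *m Q = 1%:M by exact: mulmx1C.
have d0 i : 0 < d 0 i.
  have := pA (row i Q)^T; rewrite trmxK.
  have -> : (row i Q *m A *m (row i Q)^T) 0 0 = d 0 i.
    have /matrixP/(_ i i) := QA; rewrite [RHS]mxE eqxx mulr1n => <-.
    rewrite -row_mul [in RHS]mxE dot_rV; apply: eq_bigr => k _.
    by rewrite !mxE.
  apply; apply/eqP => /(congr1 trmx); rewrite trmxK trmx0 => Q0.
  have /rowP/(_ i) : row i (Q *m Q^T) = 0 by rewrite row_mul Q0 mul0mx.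
  by rewrite QQ !mxE eqxx => /eqP; rewrite oner_eq0.
exists Q, d; split => //.
  by rewrite -QA !mulmxA QQ' mul1mx -mulmxA QQ' mulmx1.
move=> i; apply: (@sigmaE _ _ _ A d i) => // [j|]; first exact: ltW.
rewrite sA (@char_poly_orthogonal _ _ (A *m A) Q (\row_j (d 0 j ^+ 2))) //.
  by apply: eq_bigr => j _; rewrite mxE.
have -> : Q *m (A *m A) *m Q^T = (Q *m A *m Q^T) *m (Q *m A *m Q^T).
  by rewrite !mulmxA -(mulmxA _ Q^T Q) QQ' mulmx1.
rewrite QA mul_diag_mx; apply/matrixP => a b; rewrite !mxE.
by case: eqP => [->|_]; rewrite ?mulr1n ?mulr0n ?mulr0.
Qed.

End Singular.

(** * Ostrowski's inequality for congruent quadratic forms *)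

Section Ostrowski.
Context {K : realType}.

Lemma kernel_nonzero m n (A : 'M[K]_(m, n)) : (\rank A < m)%N ->
  exists2 a : 'rV[K]_m, a != 0 & a *m A = 0.
Proof.
move=> rA; have : kermx A != 0 by rewrite kermx_eq0 /row_free neq_ltn rA.
move=> /rowV0Pn[a /sub_kermxP aA a0]; by exists a.
Qed.

Lemma mul_pid_eq0 n (a : 'rV[K]_n) k : a *m (pid_mx k : 'M[K]_n) = 0 ->
  forall i : 'I_n, (i < k)%N -> a 0 i = 0.
Proof.
move=> /rowP H i ik; have := H i; rewrite !mxE (bigD1 i)//= big1 ?addr0.
  by rewrite mxE eqxx ik mulr1.
by move=> j ji; rewrite mxE (inj_eq val_inj) (negbTE ji) mulr0.
Qed.

Lemma mul_copid_eq0 n (a : 'rV[K]_n) k : a *m (copid_mx k : 'M[K]_n) = 0 ->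
  forall i : 'I_n, (k <= i)%N -> a 0 i = 0.
Proof.
move=> /rowP H i ki; have := H i; rewrite !mxE (bigD1 i)//= big1 ?addr0.
  by rewrite !mxE !eqxx ltnNge ki /= mulr1n mulr0n subr0 mulr1.
move=> j ji; rewrite !mxE (inj_eq val_inj) (negbTE ji)/=.
by rewrite mulr0n subr0 mulr0.
Qed.

Lemma rank_row_mx_le m n1 n2 (A : 'M[K]_(m, n1)) (B : 'M[K]_(m, n2)) :
  (\rank (row_mx A B) <= \rank A + \rank B)%N.
Proof.
rewrite -mxrank_tr tr_row_mx -addsmxE -[\rank A]mxrank_tr -[\rank B]mxrank_tr.
exact: mxrank_adds_leqif.
Qed.

(** There are [k] equations on [a] and n - k - 1 on [a *m M], one fewer than the [n] unknowns. *)
Lemma two_sided_kernel n (M : 'M[K]_n) (k : 'I_n) :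
  exists2 a : 'rV[K]_n, a != 0 &
    (forall i : 'I_n, (i < k)%N -> a 0 i = 0) /\
    (forall i : 'I_n, (k < i)%N -> (a *m M) 0 i = 0).
Proof.
have [|a a0] := @kernel_nonzero _ _
    (row_mx (pid_mx k : 'M[K]_n) (M *m copid_mx k.+1)).
  apply: leq_ltn_trans (rank_row_mx_le _ _) _.
  have h1 : (\rank (pid_mx k : 'M[K]_n) <= k)%N by rewrite rank_pid_mx// ltnW.
  have h2 : (\rank (M *m copid_mx k.+1) <= n - k.+1)%N.
    by rewrite (leq_trans (mxrankM_maxr _ _))// rank_copid_mx.
  by rewrite (leq_ltn_trans (leq_add h1 h2))// -ltn_subRL ltn_sub2l.
rewrite mul_mx_row -[0]row_mx0 => /eq_row_mx[a1]; rewrite mulmxA => a2.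
by exists a => //; split; [exact: mul_pid_eq0|exact: mul_copid_eq0].
Qed.

Lemma two_sided_kernel' n (M : 'M[K]_n) (k : 'I_n) :
  exists2 a : 'rV[K]_n, a != 0 &
    (forall i : 'I_n, (k < i)%N -> a 0 i = 0) /\
    (forall i : 'I_n, (i < k)%N -> (a *m M) 0 i = 0).
Proof.
have [|a a0] := @kernel_nonzero _ _
    (row_mx (copid_mx k.+1 : 'M[K]_n) (M *m (pid_mx k : 'M[K]_n))).
  apply: leq_ltn_trans (rank_row_mx_le _ _) _.
  have h1 : (\rank (M *m (pid_mx k : 'M[K]_n)) <= k)%N.
    by rewrite (leq_trans (mxrankM_maxr _ _))// rank_pid_mx// ltnW.
  have h2 : (\rank (copid_mx k.+1 : 'M[K]_n) <= n - k.+1)%N by rewrite rank_copid_mx.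
  by rewrite (leq_ltn_trans (leq_add h2 h1))// addnC -ltn_subRL ltn_sub2l.
rewrite mul_mx_row -[0]row_mx0 => /eq_row_mx[a1]; rewrite mulmxA => a2.
by exists a => //; split; [exact: mul_copid_eq0|exact: mul_pid_eq0].
Qed.

(* The vectors used are orthogonal to the leading (trailing) eigenvectors of one
   form and are mapped by [M] orthogonally to the trailing (leading) ones of the
   other; they exist by counting dimensions. *)
Lemma ostrowski n (la mu : 'rV[K]_n) (M : 'M[K]_n) (c1 c2 : K) :
  (forall i j : 'I_n, (i <= j)%N -> la 0 j <= la 0 i) ->
  (forall i j : 'I_n, (i <= j)%N -> mu 0 j <= mu 0 i) ->
  (forall a : 'rV[K]_n, \sum_i la 0 i * a 0 i ^+ 2 =
     \sum_i mu 0 i * (a *m M) 0 i ^+ 2) ->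
  (forall a : 'rV[K]_n, c1 * (\sum_i a 0 i ^+ 2) <= \sum_i (a *m M) 0 i ^+ 2) ->
  (forall a : 'rV[K]_n, \sum_i (a *m M) 0 i ^+ 2 <= c2 * (\sum_i a 0 i ^+ 2)) ->
  forall k, sandwiched (la 0 k) (c1 * mu 0 k) (c2 * mu 0 k).
Proof.
move=> sla smu q lb ub k.
have pos (a : 'rV[K]_n) : a != 0 -> 0 < \sum_i a 0 i ^+ 2.
  move=> a0; have -> : \sum_i a 0 i ^+ 2 = (a *m a^T) 0 0.
    by rewrite dot_rV; apply: eq_bigr.
  by rewrite lt0r sqr_rV_eq0 a0 sqr_rV_ge0.
apply/andP; split.
- have [a a0 [H1 H2]] := two_sided_kernel M k.
  rewrite -(ler_pM2r (pos _ a0)).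
  apply: (@le_trans _ _ (mu 0 k * \sum_i (a *m M) 0 i ^+ 2)).
    (* The sign of [mu 0 k] decides which of the two bounds on the norm of [a *m M] is useful; the
       minimum covers both cases. *)
    have [m0|m0] := leP 0 (mu 0 k).
      apply: le_trans (_ : c1 * mu 0 k * (\sum_i a 0 i ^+ 2) <= _).
        by apply: ler_wpM2r; [exact/ltW/pos|rewrite ge_min lexx].
      by rewrite mulrAC mulrC ler_wpM2l.
    apply: le_trans (_ : c2 * mu 0 k * (\sum_i a 0 i ^+ 2) <= _).
      by apply: ler_wpM2r; [exact/ltW/pos|rewrite ge_min lexx orbT].
    by rewrite mulrAC mulrC ler_wnM2l// ltW.
  apply: (@le_trans _ _ (\sum_i mu 0 i * (a *m M) 0 i ^+ 2)).
    rewrite mulr_sumr ler_sum// => i _; have [ik|ki] := leqP i k.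
      by apply: ler_wpM2r; [exact: sqr_ge0|exact: smu].
    by rewrite H2// expr0n/= !mulr0.
  rewrite -q mulr_sumr ler_sum// => i _; have [ki|ik] := leqP k i.
    by apply: ler_wpM2r; [exact: sqr_ge0|exact: sla].
  by rewrite H1// expr0n/= !mulr0.
- have [a a0 [H1 H2]] := two_sided_kernel' M k.
  rewrite -(ler_pM2r (pos _ a0)).
  apply: (@le_trans _ _ (mu 0 k * \sum_i (a *m M) 0 i ^+ 2)); last first.
    have [m0|m0] := leP 0 (mu 0 k).
      apply: le_trans (_ : c2 * mu 0 k * (\sum_i a 0 i ^+ 2) <= _).
        by rewrite [leRHS]mulrAC [leRHS]mulrC ler_wpM2l.
      by apply: ler_wpM2r; [exact/ltW/pos|rewrite le_max lexx orbT].
    apply: le_trans (_ : c1 * mu 0 k * (\sum_i a 0 i ^+ 2) <= _).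
      by rewrite [leRHS]mulrAC [leRHS]mulrC ler_wnM2l// ltW.
    by apply: ler_wpM2r; [exact/ltW/pos|rewrite le_max lexx].
  apply: (@le_trans _ _ (\sum_i mu 0 i * (a *m M) 0 i ^+ 2)); last first.
    rewrite mulr_sumr ler_sum// => i _; have [ki|ik] := leqP k i.
      by apply: ler_wpM2r; [exact: sqr_ge0|exact: smu].
    by rewrite H2// expr0n/= !mulr0.
  rewrite -q mulr_sumr ler_sum// => i _; have [ik|ki] := leqP i k.
    by apply: ler_wpM2r; [exact: sqr_ge0|exact: sla].
  by rewrite H1// expr0n/= !mulr0.
Qed.

End Ostrowski.

(** * Eigenvalues of self-adjoint operators on a subspace *)

Section Eigenbasis.
Context {K : realType} {E : normedModType K}.
Implicit Types (H : set E) (T : E -> E).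

(** Coordinates are row vectors, so that operators and changes of basis multiply on the right, as in
    [eigenvalues]. *)
Definition lincomb d (e : 'I_d -> E) (a : 'rV[K]_d) : E := \sum_i a 0 i *: e i.

Lemma lincombP d (e : 'I_d -> E) c a b :
  lincomb e (c *: a + b) = c *: lincomb e a + lincomb e b.
Proof.
rewrite /lincomb scaler_sumr -big_split; apply: eq_bigr => i _.
by rewrite !mxE scalerDl scalerA.
Qed.

Lemma lincombE d (e : 'I_d -> E) (a : 'I_d -> K) :
  \sum_i a i *: e i = lincomb e (\row_i a i).
Proof. by apply: eq_bigr => i _; rewrite mxE. Qed.

Lemma lincomb_delta d (e : 'I_d -> E) i : lincomb e (delta_mx 0 i) = e i.
Proof.
rewrite /lincomb (bigD1 i)//= big1 ?addr0 => [|j ji].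
  by rewrite mxE !eqxx scale1r.
by rewrite mxE (negbTE ji) andbF scale0r.
Qed.

Lemma lincomb_sum d (e : 'I_d -> E) (I : Type) (s : seq I) (c : I -> K)
    (a : I -> 'rV[K]_d) :
  lincomb e (\sum_(i <- s) c i *: a i) = \sum_(i <- s) c i *: lincomb e (a i).
Proof.
elim: s => [|i s IH].
  by rewrite !big_nil /lincomb big1// => i _; rewrite mxE scale0r.
by rewrite !big_cons lincombP IH.
Qed.

Lemma lincomb_mulmx d n (e : 'I_d -> E) (M : 'M[K]_(n, d)) (a : 'rV[K]_n) :
  lincomb (fun i => lincomb e (row i M)) a = lincomb e (a *m M).
Proof. by rewrite mulmx_sum_row lincomb_sum. Qed.

Section Basis.
Variables (H : set E) (d : nat) (e : 'I_d -> E).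
Hypothesis He : is_basis H e.

Lemma basis_mem a : H (lincomb e a).
Proof. by apply: (He.1 _).2; exists (a 0). Qed.

Lemma basis_coord v : H v -> exists a, v = lincomb e a.
Proof. by move=> /(He.1 _).1[a ->]; exists (\row_i a i); exact: lincombE. Qed.

Lemma basis_eq0 a : lincomb e a = 0 -> a = 0.
Proof. by move=> /He.2 a0; apply/rowP => i; rewrite mxE. Qed.

Lemma basis_inj : injective (lincomb e).
Proof.
move=> a b ab; apply/eqP; rewrite -subr_eq0; apply/eqP/basis_eq0.
by rewrite -scaleN1r addrC lincombP ab scaleN1r addNr.
Qed.

Lemma basis_change (P : 'M[K]_d) : P \in unitmx ->
  is_basis H (fun i => lincomb e (row i P)).
Proof.
move=> Pu; split=> [v|a]; last first.
  rewrite lincombE lincomb_mulmx => /basis_eq0 aP i.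
  suff /rowP/(_ i) : \row_i a i = 0 by rewrite !mxE.
  by rewrite -[LHS](mulmxK Pu) aP mul0mx.
split=> [/basis_coord[a ->]|[a ->]].
  exists ((a *m invmx P) 0).
  rewrite (_ : \sum_i _ = lincomb (fun i => lincomb e (row i P)) (a *m invmx P))//.
  by rewrite lincomb_mulmx mulmxKV.
by rewrite lincombE lincomb_mulmx; exact: basis_mem.
Qed.

End Basis.

Section Operator.
Variables (H : set E) (T : E -> E).
Hypothesis TH : forall v, H v -> H (T v).
Hypothesis Tlin : forall c u v, H u -> H v -> T (c *: u + v) = c *: T u + T v.

Lemma operator_lincomb d (e : 'I_d -> E) (A : 'M[K]_d) : is_basis H e ->
  (forall i, T (e i) = lincomb e (row i A)) ->
  forall a, T (lincomb e a) = lincomb e (a *m A).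
Proof.
move=> He TA a.
have H0 : H 0.
  have := basis_mem He 0; rewrite /lincomb big1// => i _.
  by rewrite mxE scale0r.
have T0 : T 0 = 0.
  have := @Tlin (-1) 0 0 H0 H0; rewrite scaler0 addr0 => ->.
  by rewrite scaleN1r addNr.
rewrite -lincomb_mulmx /lincomb.
(* [T] is linear only on [H], so membership of the partial sums is carried through the induction. *)
have : forall s : seq 'I_d, H (\sum_(i <- s) a 0 i *: e i) /\
  T (\sum_(i <- s) a 0 i *: e i) = \sum_(i <- s) a 0 i *: lincomb e (row i A).
  elim => [|i s [Hs Ts]]; first by rewrite !big_nil.
  have Hei : H (e i) by rewrite -lincomb_delta; exact: (basis_mem He).
  rewrite !big_cons Tlin// Ts TA; split => //.
  have [b ->] := basis_coord He Hs; rewrite -[e i]lincomb_delta -lincombP.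
  exact: basis_mem.
by move=> /(_ (index_enum _))[].
Qed.

Lemma operator_mx d (e : 'I_d -> E) : is_basis H e ->
  exists A : 'M[K]_d, forall i, T (e i) = lincomb e (row i A).
Proof.
move=> He; have /choice[f Hf] : forall i, exists a : 'rV[K]_d, T (e i) = lincomb e a.
  move=> i; apply: (basis_coord He); apply: TH.
  by rewrite -lincomb_delta; exact: (basis_mem He).
by exists (\matrix_i f i) => i; rewrite rowK.
Qed.

(** [eigenvalues] admits any basis of any length. Two bases are related by mutually inverse
    matrices, which forces equal lengths and conjugates the matrices of [T]. *)
Lemma eigenvaluesE d (e : 'I_d -> E) (la : 'rV[K]_d) : is_basis H e ->
  (forall i, T (e i) = la 0 i *: e i) ->
  (forall i j : 'I_d, (i <= j)%N -> la 0 j <= la 0 i) ->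
  eigenvalues H T = [seq la 0 i | i <- enum 'I_d].
Proof.
move=> He Te sla; have TD : forall i, T (e i) = lincomb e (row i (diag_mx la)).
  by move=> i; rewrite Te row_diag_mx -[_ *: delta_mx 0 i]addr0 lincombP
    lincomb_delta /lincomb [X in _ + X]big1 ?addr0// => j _; rewrite mxE scale0r.
apply: xget_unique.
  split; first exact: sorted_enum_rV.
  exists d, e, (diag_mx la); split => //.
    by move=> i; rewrite TD; apply: eq_bigr => j _; rewrite mxE.
  by rewrite char_poly_diag big_map big_enum.
move=> s [ss [d' [e' [A [He' TA cA]]]]].
have {}TA : forall i, T (e' i) = lincomb e' (row i A).
  by move=> i; rewrite TA; apply: eq_bigr => j _; rewrite mxE.
have He'i i : H (e' i) by rewrite -lincomb_delta; exact: (basis_mem He').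
have Hei i : H (e i) by rewrite -lincomb_delta; exact: (basis_mem He).
have /choice[P HP] : forall i, exists a, e' i = lincomb e a.
  by move=> i; exact: (basis_coord He).
have /choice[P' HP'] : forall i, exists a, e i = lincomb e' a.
  by move=> i; exact: (basis_coord He').
pose M := \matrix_i P i; pose M' := \matrix_i P' i.
have eM a : lincomb e' a = lincomb e (a *m M).
  by rewrite -lincomb_mulmx; apply: eq_bigr => i _; rewrite rowK HP.
have eM' a : lincomb e a = lincomb e' (a *m M').
  by rewrite -lincomb_mulmx; apply: eq_bigr => i _; rewrite rowK HP'.
have MM' : M *m M' = 1%:M.
  apply/row_matrixP => i; apply: (basis_inj He').
  by rewrite !rowE mulmx1 mulmxA -eM' -eM.
have M'M : M' *m M = 1%:M.
  apply/row_matrixP => i; apply: (basis_inj He).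
  by rewrite !rowE mulmx1 mulmxA -eM -eM'.
have dd' : d' = d.
  apply/eqP; rewrite eqn_leq; apply/andP; split.
    by rewrite -(mxrank1 K d') -MM' (leq_trans (mxrankM_maxl _ _))// rank_leq_col.
  by rewrite -(mxrank1 K d) -M'M (leq_trans (mxrankM_maxl _ _))// rank_leq_col.
subst d'; apply: sorted_prod_XsubC_inj => //; first exact: sorted_enum_rV.
rewrite -cA big_map big_enum -char_poly_diag.
rewrite -(@char_poly_conj _ _ (diag_mx la) M M')//; congr char_poly.
apply/row_matrixP => i; apply: (basis_inj He').
rewrite -TA HP (operator_lincomb He TD) eM'; congr lincomb.
by rewrite !row_mul rowK.
Qed.

Variable g : E -> E -> K.
Hypothesis gP : forall c u v w, g (c *: u + v) w = c * g u w + g v w.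
Hypothesis gC : forall u v, g u v = g v u.
Hypothesis g_gt0 : forall u, u != 0 -> 0 < g u u.

Lemma g_lincomb d (e : 'I_d -> E) a b :
  g (lincomb e a) (lincomb e b) = (a *m (\matrix_(i, j) g (e i) (e j)) *m b^T) 0 0.
Proof.
have g0 w : g 0 w = 0.
  by have := gP (-1) 0 0 w; rewrite scaler0 addr0 mulN1r addNr.
have gsum (I : Type) (s : seq I) (c : I -> K) (f : I -> E) w :
    g (\sum_(i <- s) c i *: f i) w = \sum_(i <- s) c i * g (f i) w.
  by elim: s => [|i s IH]; rewrite ?big_nil// !big_cons gP IH.
rewrite /lincomb gC gsum mxE; apply: eq_bigr => j _.
rewrite gC gsum mulrC !mxE; congr (_ * _).
by apply: eq_bigr => i _; rewrite mxE.
Qed.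

(** Simultaneous diagonalization of two forms. With G the Gram matrix of [e] and A the matrix of
    [T], self-adjointness says that A G is symmetric; [P0] turns G into the identity, and an
    orthogonal [Q2] then diagonalizes the transformed A G. *)
Lemma orthonormal_eigenbasis d (e : 'I_d -> E) : is_basis H e ->
  (forall u v, H u -> H v -> g (T u) v = g u (T v)) ->
  exists (f : 'I_d -> E) (la : 'rV[K]_d), [/\ is_basis H f,
    forall a, g (lincomb f a) (lincomb f a) = \sum_i a 0 i ^+ 2,
    forall i, T (f i) = la 0 i *: f i,
    forall a, g (T (lincomb f a)) (lincomb f a) = \sum_i la 0 i * a 0 i ^+ 2 &
    forall i j : 'I_d, (i <= j)%N -> la 0 j <= la 0 i].
Proof.
move=> He Tsym; have [A TA] := operator_mx He.
have TL := operator_lincomb He TA.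
have [G [gG sG]] : exists G : 'M[K]_d,
    (forall a b, g (lincomb e a) (lincomb e b) = (a *m G *m b^T) 0 0) /\ G^T = G.
  exists (\matrix_(i, j) g (e i) (e j)); split; first exact: g_lincomb.
  by apply/matrixP => i j; rewrite !mxE gC.
have Gpos : pos_def G.
  split => // x x0; rewrite -{2}[x]trmxK -gG; apply: g_gt0.
  apply: contra_neq x0 => /(basis_eq0 He) /(congr1 trmx).
  by rewrite trmxK trmx0.
have [Q [dl [QQ GE d0 _ _]]] := pos_def_spectral Gpos.
have QQ' : Q^T *m Q = 1%:M by exact: mulmx1C.
have [P0 P0G] : exists P0 : 'M[K]_d, P0 *m G *m P0^T = 1%:M.
  (* This is D^(-1/2) Q for the diagonalization G = Q^T D Q. *)
  exists (diag_mx (\row_i (Num.sqrt (dl 0 i))^-1) *m Q).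
  rewrite GE trmx_mul tr_diag_mx !mulmxA -(mulmxA _ Q Q^T) QQ mulmx1.
  rewrite -(mulmxA _ Q Q^T) QQ mulmx1 !mulmx_diag -diag_const_mx.
  congr diag_mx; apply/rowP => i; rewrite !mxE.
  have s0 : Num.sqrt (dl 0 i) != 0 by rewrite gt_eqF// sqrtr_gt0.
  by rewrite -{2}[dl 0 i]sqr_sqrtr ?ltW// expr2 mulrA mulVf// mul1r divff.
have sAG : (A *m G)^T = A *m G.
  apply/matrixP => i j; rewrite mxE.
  have E1 k l : (A *m G) k l = g (T (e k)) (e l).
    rewrite TA -[e l]lincomb_delta gG trmx_delta -row_mul -colE.
    by rewrite [RHS]mxE [RHS]mxE.
  have Hei k : H (e k) by rewrite -lincomb_delta; exact: (basis_mem He).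
  by rewrite !E1 Tsym// gC.
pose S := P0 *m A *m G *m P0^T.
have sS : S^T = S.
  rewrite /S -(mulmxA P0 A) (trmx_mul (P0 *m (A *m G))) (trmx_mul P0) trmxK sAG.
  by rewrite !mulmxA.
have [Q2 [la [QQ2 SE sla]]] := spectral_theorem sS.
have [P PE] : exists P : 'M[K]_d, P = Q2 *m P0 by exists (Q2 *m P0).
have PG : P *m G *m P^T = 1%:M.
  by rewrite PE trmx_mul !mulmxA -(mulmxA Q2 P0) -(mulmxA Q2 _ P0^T) P0G mulmx1.
have PA : P *m A *m G *m P^T = diag_mx la.
  by rewrite -SE /S PE trmx_mul !mulmxA.
have Pu : P \in unitmx by move: PG; rewrite -mulmxA => /mulmx1_unit[].
(* Orthonormality makes G P^T the inverse of P, so a diagonal form becomes an eigenvector equation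
   for the operator. *)
have PA' : P *m A = diag_mx la *m P.
  have PGP : G *m P^T *m P = 1%:M by apply: mulmx1C; rewrite mulmxA.
  by rewrite -PA -!mulmxA (mulmxA G) PGP mulmx1.
pose f i := lincomb e (row i P).
have fP a : lincomb f a = lincomb e (a *m P) by exact: lincomb_mulmx.
have Tf i : T (f i) = la 0 i *: f i.
  rewrite /f TL -row_mul PA' row_mul row_diag_mx -scalemxAl -rowE.
  rewrite -[_ *: row i P]addr0 lincombP /lincomb [X in _ + X]big1 ?addr0//.
  by move=> k _; rewrite mxE scale0r.
exists f, la; split => //; first exact: basis_change.
- move=> a; rewrite fP gG trmx_mul !mulmxA -(mulmxA a P) -(mulmxA a _ P^T) PG.
  by rewrite mulmx1 dot_rV.
- move=> a; rewrite fP TL gG trmx_mul !mulmxA -(mulmxA a P) -(mulmxA a _ G).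
  rewrite -(mulmxA a _ P^T) PA mul_mx_diag mxE; apply: eq_bigr => i _.
  by rewrite !mxE expr2 mulrAC mulrC mulrA.
Qed.

End Operator.

End Eigenbasis.

(** * The geometry of matrices of fixed rank *)

Section Frobenius.
Context {K : realType}.

Definition frob m n (A B : 'M[K]_(m, n)) : K := \tr (A^T *m B).

Lemma frobE m n (A B : 'M[K]_(m, n)) : frob A B = \sum_j \sum_i A i j * B i j.
Proof.
by apply: eq_bigr => j _; rewrite mxE; apply: eq_bigr => i _; rewrite mxE.
Qed.

Lemma frobC m n (A B : 'M[K]_(m, n)) : frob A B = frob B A.
Proof. by rewrite /frob -mxtrace_tr trmx_mul trmxK. Qed.

Lemma frobDl m n (A A' B : 'M[K]_(m, n)) : frob (A + A') B = frob A B + frob A' B.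
Proof. by rewrite /frob linearD/= mulmxDl mxtraceD. Qed.

Lemma frobBl m n (A A' B : 'M[K]_(m, n)) : frob (A - A') B = frob A B - frob A' B.
Proof. by rewrite /frob linearB/= mulmxBl linearB. Qed.

Lemma frobDr m n (A B B' : 'M[K]_(m, n)) : frob A (B + B') = frob A B + frob A B'.
Proof. by rewrite frobC frobDl !(frobC A). Qed.

Lemma frobBr m n (A B B' : 'M[K]_(m, n)) : frob A (B - B') = frob A B - frob A B'.
Proof. by rewrite frobC frobBl !(frobC A). Qed.

Lemma frobZl m n c (A B : 'M[K]_(m, n)) : frob (c *: A) B = c * frob A B.
Proof. by rewrite /frob linearZ/= -scalemxAl mxtraceZ. Qed.

Lemma frob0r m n (A : 'M[K]_(m, n)) : frob A 0 = 0.
Proof. by rewrite /frob mulmx0 mxtrace0. Qed.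

Lemma frob_mulr m n p (A : 'M[K]_(m, p)) (B : 'M[K]_(m, n)) (C : 'M[K]_(n, p)) :
  frob A (B *m C) = frob (A *m C^T) B.
Proof. by rewrite /frob trmx_mul trmxK mulmxA mxtrace_mulC mulmxA. Qed.

Lemma frob_mull m n p (A : 'M[K]_(m, p)) (B : 'M[K]_(m, n)) (C : 'M[K]_(n, p)) :
  frob A (B *m C) = frob (B^T *m A) C.
Proof. by rewrite /frob trmx_mul trmxK mulmxA. Qed.

Lemma frob_tr m n (A B : 'M[K]_(m, n)) : frob A^T B^T = frob A B.
Proof. by rewrite /frob trmxK mxtrace_mulC -mxtrace_tr trmx_mul trmxK. Qed.

Lemma frob_ge0 m n (A : 'M[K]_(m, n)) : 0 <= frob A A.
Proof. by rewrite frobE; do 2![apply: sumr_ge0 => ? _]; rewrite -expr2 sqr_ge0. Qed.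

Lemma frob_eq0 m n (A : 'M[K]_(m, n)) : frob A A = 0 -> A = 0.
Proof.
rewrite frobE => H; apply/matrixP => i j; rewrite mxE; apply/eqP.
have H1 j' : 0 <= \sum_i A i j' * A i j'.
  by apply: sumr_ge0 => k _; rewrite -expr2 sqr_ge0.
have /psumr_eq0P/(_ j isT) H2 := H.
have /psumr_eq0P/(_ i isT) := H2 (fun j' _ => H1 j').
rewrite -expr2 => H3; rewrite -sqrf_eq0; apply/eqP/H3 => k _.
by rewrite -expr2 sqr_ge0.
Qed.

End Frobenius.

Section Left_inverse.
Context {K : realType} (p r : nat).
Implicit Types A : 'M[K]_(p, r).

Definition linv A : 'M[K]_(r, p) := invmx (A^T *m A) *m A^T.

(** For full column rank, the orthogonal projection onto the column space; written P_L and P_R below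
    for the two factors. *)
Definition pj A : 'M[K]_p := A *m linv A.

Lemma linvK A : \rank A = r -> linv A *m A = 1%:M.
Proof. by move=> rA; rewrite /linv -mulmxA mulVmx// gram_unit. Qed.

Lemma pjK A : \rank A = r -> pj A *m A = A.
Proof. by move=> rA; rewrite /pj -mulmxA linvK// mulmx1. Qed.

Lemma pjT A : (pj A)^T = pj A.
Proof.
by rewrite /pj /linv !trmx_mul trmxK trmx_inv trmx_mul trmxK mulmxA.
Qed.

Lemma trK_pj A : \rank A = r -> A^T *m pj A = A^T.
Proof. by move=> rA; rewrite -pjT -trmx_mul pjK. Qed.

Lemma mp_inverse_linv A : \rank A = r -> mp_inverse A = linv A.
Proof.
move=> rA; have AB : (A *m linv A)^T = A *m linv A by rewrite -/(pj A) pjT.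
apply: xget_unique => [|B [B1 B2 B3 B4]].
  rewrite /= linvK// trmx1; split => //; first by rewrite -mulmxA linvK// mulmx1.
  by rewrite mul1mx.
have BA : B *m A = 1%:M.
  have /(congr1 (mulmx (linv A))) := B1.
  by rewrite !mulmxA linvK// mul1mx.
have e : A *m B = A *m linv A.
  rewrite -B3 trmx_mul.
  rewrite -{1}(pjK rA) trmx_mul pjT mulmxA -trmx_mul B3 /pj !mulmxA.
  by rewrite -(mulmxA A B) BA mulmx1.
have /(congr1 (mulmx (linv A))) := e.
by rewrite !mulmxA linvK// !mul1mx.
Qed.

End Left_inverse.

(** * Rank factorizations, their orbits and a local section *)

Section Factorizations.
Context {K : realType} (p1 p2 r : nat).
Local Notation total := ('M[K]_(p1, r) * 'M[K]_(p2, r))%type.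
Implicit Types (x y theta : total) (M : 'M[K]_r) (X Y : 'M[K]_(p1, p2)).

Lemma rank_mulmx_tr m n (A : 'M[K]_(m, r)) (B : 'M[K]_(n, r)) :
  \rank A = r -> \rank B = r -> \rank (A *m B^T) = r.
Proof. by move=> rA rB; rewrite mxrankMfree// /row_free mxrank_tr rB. Qed.

Lemma product_rank x : total_space x -> \rank (product x) = r.
Proof. by move=> [r1 r2]; exact: rank_mulmx_tr. Qed.

Lemma rank_product x : \rank (product x) = r -> total_space x.
Proof.
move=> rx; split; apply/eqP; rewrite eqn_leq rank_leq_col/= -{1}rx.
  exact: mxrankM_maxl.
by rewrite -[X in (_ <= X)%N]mxrank_tr; exact: mxrankM_maxr.
Qed.

Lemma rank_factor Y : \rank Y = r -> exists2 x : total, total_space x & product x = Y.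
Proof.
move=> rY; have [x xY] : exists x : total, product x = Y.
  move: rY; set k := \rank Y => kr.
  rewrite -kr; exists (col_base Y, (row_base Y)^T).
  by rewrite /product/= trmxK mulmx_base.
by exists x => //; apply: rank_product; rewrite xY.
Qed.

Lemma product_act x M : M \in unitmx -> product (act x M) = product x.
Proof. by move=> Mu; rewrite /product/= trmx_mul trmxK mulmxA mulmxK. Qed.

Lemma act_total x M : M \in unitmx -> total_space x -> total_space (act x M).
Proof. by move=> Mu xt; apply: rank_product; rewrite product_act// product_rank. Qed.

(** Cancelling [y.2] by its left inverse gives y.1 = x.1 M. Thus the fibers of the product map are
    single orbits. *)
Lemma factor_act x y : total_space x -> total_space y -> product x = product y ->
  exists2 M, M \in unitmx & y = act x M.
Proof.
move=> [x1 x2] [y1 y2] xy; pose M := x.2^T *m (linv y.2)^T.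
have eM : y.1 = x.1 *m M.
  rewrite /M mulmxA -/(product x) xy /product -mulmxA -trmx_mul linvK//.
  by rewrite trmx1 mulmx1.
have Mu : M \in unitmx.
  rewrite -row_full_unit /row_full eqn_leq rank_leq_col/= -{1}y1 eM.
  exact: mxrankM_maxr.
exists M => //; rewrite [LHS]surjective_pairing /act -eM; congr pair.
have e : x.2^T = M *m y.2^T.
  move: xy; rewrite /product eM -mulmxA => /(congr1 (mulmx (linv x.1))).
  by rewrite !mulmxA linvK// !mul1mx.
have -> : x.2 = y.2 *m M^T by rewrite -[LHS]trmxK e trmx_mul trmxK.
by rewrite -mulmxA -trmx_mul mulVmx// trmx1 mulmx1.
Qed.

Lemma tangent_map_act x theta M : M \in unitmx ->
  tangent_map (act x M) (act theta M) = tangent_map x theta.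
Proof.
move=> Mu; rewrite /tangent_map/= !trmx_mul trmxK !mulmxA.
by rewrite !(mulmxK Mu).
Qed.

Lemma act_actV theta M : M \in unitmx -> act (act theta (invmx M)) M = theta.
Proof.
move=> Mu; rewrite /act/= invmxK mulmxKV// -mulmxA -trmx_mul.
by rewrite mulVmx// trmx1 mulmx1; case: theta.
Qed.

(** A local section of the product map near [product x]: the two factors multiply to Y R (L^T Y
    R)^-1 L^T Y, which is Y when Y has rank r. It sends [product x] into the fiber of [x], but in
    general not to [x] itself. *)
Definition sec (x : total) (Y : 'M[K]_(p1, p2)) : total :=
  (Y *m x.2, (adj_inv (x.1^T *m Y *m x.2) *m x.1^T *m Y)^T).

Definition sec_dom (x : total) (Y : 'M[K]_(p1, p2)) : Prop :=
  \rank Y = r /\ x.1^T *m Y *m x.2 \in unitmx.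

Lemma product_sec x Y : sec_dom x Y -> product (sec x Y) = Y.
Proof.
move=> [/rank_factor[y _ <-]] Nu; rewrite /product /sec/= trmxK adj_invE//.
set N := x.1^T *m _ *m x.2 in Nu *.
have NE : N = (x.1^T *m y.1) *m (y.2^T *m x.2) by rewrite /N /product !mulmxA.
(* A one-sided inverse of a square matrix is two-sided, which lets [x.1^T *m y.1] move to the other
   end of the product. *)
have : (y.2^T *m x.2 *m invmx N) *m (x.1^T *m y.1) = 1%:M.
  by apply: mulmx1C; rewrite mulmxA -NE mulmxV.
rewrite !mulmxA => e.
have -> : y.1 *m y.2^T *m x.2 *m invmx N *m x.1^T *m y.1 *m y.2^T =
  y.1 *m (y.2^T *m x.2 *m invmx N *m x.1^T *m y.1) *m y.2^T by rewrite !mulmxA.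
by rewrite e mulmx1.
Qed.

Lemma sec_total x Y : sec_dom x Y -> total_space (sec x Y).
Proof. by move=> xY; apply: rank_product; rewrite product_sec//; case: xY. Qed.

Lemma sec_unit x : total_space x -> x.1^T *m product x *m x.2 \in unitmx.
Proof.
move=> [x1 x2]; rewrite /product mulmxA -mulmxA unitmx_mul.
by rewrite !gram_unit.
Qed.

Lemma C1_at_id (E : normedModType K) (y : E) : C1_at (id : E -> E) y.
Proof. by apply: (@C1_at_lin _ _ _ idfun) => z; exact: cvg_id. Qed.

Lemma near_sec_unit x : total_space x ->
  \forall Y \near product x, x.1^T *m Y *m x.2 \in unitmx.
Proof.
move=> xt; apply: near_unitmx; last exact: sec_unit.
apply: C1_at_cont; apply: C1_at_mulmx; last exact: C1_at_cst.
by apply: C1_at_mulmx; [exact: C1_at_cst|exact: C1_at_id].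
Qed.

Lemma C1_at_sec x Y : x.1^T *m Y *m x.2 \in unitmx -> C1_at (sec x) Y.
Proof.
move=> Nu; apply: C1_at_pair.
  by apply: C1_at_mulmx; [exact: C1_at_id|exact: C1_at_cst].
apply: C1_at_trmx; apply: C1_at_mulmx; last exact: C1_at_id.
apply: C1_at_mulmx; last exact: C1_at_cst.
apply: C1_at_inv_mx => //; apply: C1_at_mulmx; last exact: C1_at_cst.
by apply: C1_at_mulmx; [exact: C1_at_cst|exact: C1_at_id].
Qed.

Lemma C1_at_product (E : normedModType K) (f : E -> total) (e : E) :
  C1_at f e -> C1_at (fun z => product (f z)) e.
Proof.
move=> cf; apply: C1_at_mulmx; first exact: C1_at_fst.
by apply: C1_at_trmx; exact: C1_at_snd.
Qed.

(** [linv x.1 *m y.1] and [linv x.2 *m y.2] are the identity at [x], hence invertible nearby, which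
    forces full column rank. *)
Lemma near_total_space x : total_space x -> \forall y \near x, total_space y.
Proof.
move=> xt; have [x1 x2] := xt.
have n1 : \forall y \near x, linv x.1 *m y.1 \in unitmx.
  apply: near_unitmx; last by rewrite linvK// unitmx1.
  apply: C1_at_cont; apply: C1_at_mulmx; first exact: C1_at_cst.
  by apply: C1_at_fst; exact: C1_at_id.
have n2 : \forall y \near x, linv x.2 *m y.2 \in unitmx.
  apply: near_unitmx; last by rewrite linvK// unitmx1.
  apply: C1_at_cont; apply: C1_at_mulmx; first exact: C1_at_cst.
  by apply: C1_at_snd; exact: C1_at_id.
have rk m (A : 'M[K]_(r, m)) (B : 'M[K]_(m, r)) : A *m B \in unitmx -> \rank B = r.
  rewrite -row_full_unit => /eqP AB; apply/eqP.
  by rewrite eqn_leq rank_leq_col/= -{1}AB mxrankM_maxr.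
by apply: filterS2 n1 n2 => y /rk r1 /rk r2.
Qed.

Lemma near_product_sec x : total_space x ->
  \forall Y \near product x, \rank Y = r -> product (sec x Y) = Y.
Proof.
move=> xt; apply: filterS (near_sec_unit xt) => Y Nu rY.
by apply: product_sec.
Qed.

Lemma tangent_map_curve x theta :
  is_derive (0 : K) (1 : K) (fun t : K => product (x + t *: theta))
    (tangent_map x theta).
Proof.
have line m n (A B : 'M[K]_(m, n)) :
    is_derive (0 : K) (1 : K) (fun t : K => A + t *: B) B.
  have := @is_derive_line K 'M[K]_(m, n) 'M[K]_(m, n) id A B 0 (C1_at_diff (C1_at_id _)).
  by rewrite derive_id.
have := is_derive_mulmx (line _ _ x.1 theta.1)
  (is_derive_trmx (line _ _ x.2 theta.2)).
by rewrite !scale0r !addr0 /tangent_map addrC.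
Qed.

Lemma is_derive_comp_curve (E F : normedModType K) (f : E -> F) (c : K -> E) t v :
  differentiable f (c t) -> is_derive t (1 : K) c v ->
  is_derive t (1 : K) (fun s => f (c s)) ('d f (c t) v).
Proof.
move=> df dc; have dc1 : differentiable c t by exact/derivable1_diffP.
have dfc : differentiable (f \o c) t by exact: differentiable_comp.
apply: DeriveDef; first by apply: diff_derivable; exact: dfc.
have e : 'd c t 1 = v by rewrite -deriveE//; case: dc.
by rewrite (@deriveE _ _ _ (f \o c) t 1 dfc) (diff_comp dc1 df)/= e.
Qed.

Lemma is_derive_lin_curve (E F : normedModType K) (f : {linear E -> F}) (c : K -> E) t v :
  continuous f -> is_derive t (1 : K) c v ->
  is_derive t (1 : K) (fun s => f (c s)) (f v).
Proof.
move=> cf dc; have df : differentiable f (c t) by exact: linear_differentiable.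
by have := is_derive_comp_curve df dc; rewrite diff_lin.
Qed.

Lemma is_derive_product (y : K -> total) t v : is_derive t (1 : K) y v ->
  is_derive t (1 : K) (fun s => product (y s)) (tangent_map (y t) v).
Proof.
move=> dy.
have := is_derive_mulmx
  (is_derive_lin_curve (@fst_lin_continuous K 'M[K]_(p1, r) 'M[K]_(p2, r)) dy)
  (is_derive_trmx
  (is_derive_lin_curve (@snd_lin_continuous K 'M[K]_(p1, r) 'M[K]_(p2, r)) dy)).
by rewrite /tangent_map addrC.
Qed.

(** A line in the total space projects to a curve of rank-r matrices. Conversely [sec] lifts such a
    curve, and the velocity of the lift is a preimage of [v]. *)
Lemma tangent_fixed_rank x v : total_space x ->
  tangent_space (fixed_rank r) (product x) v <->
  exists theta, v = tangent_map x theta.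
Proof.
move=> xt; split=> [[c [c0 cM dc]]|[theta ->]]; last first.
  exists (fun t => product (x + t *: theta)); split.
  - by rewrite scale0r addr0.
  - have cl : {for (0 : K), continuous (fun t : K => x + t *: theta)}.
      apply: differentiable_continuous.
      have h := @is_derive_line K total total id x theta 0 (C1_at_diff (C1_at_id _)).
      by apply/derivable1_diffP; exact: ex_derive.
    have : \forall t \near (0 : K), total_space (x + t *: theta).
      have n : nbhs (x + (0 : K) *: theta) (@total_space K p1 p2 r).
        by rewrite scale0r addr0; exact: near_total_space.
      exact: (cl _ n).
    by apply: filterS => t; exact: product_rank.
  - exact: tangent_map_curve.
have cc : {for (0 : K), continuous c}.
  by apply: differentiable_continuous; apply/derivable1_diffP; case: dc.
have ds : differentiable (sec x) (c 0).
  by rewrite c0; apply: C1_at_diff; apply: C1_at_sec; exact: sec_unit.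
have dy := is_derive_comp_curve ds dc.
set w := 'd (sec x) (c 0) v in dy.
have nc : \forall t \near (0 : K), product (sec x (c t)) = c t.
  have h : \forall t \near (0 : K), \rank (c t) = r -> product (sec x (c t)) = c t.
    have n : nbhs (c 0) [set Y | \rank Y = r -> product (sec x Y) = Y].
      by rewrite c0; exact: near_product_sec.
    exact: (cc _ n).
  by apply: filterS2 h cM => t; apply.
have s0 : product (sec x (c 0)) = product x by rewrite (nbhs_singleton nc) c0.
have st : total_space (sec x (c 0)).
  by apply: rank_product; rewrite s0 product_rank.
have [M Mu yM] := factor_act xt st (esym s0).
have -> : v = tangent_map (sec x (c 0)) w.
  have := near_eq_is_derive nc (is_derive_product dy).
  by move=> [_ <-]; case: dc => _ <-.
(* The lift starts at [act x M] instead of [x], so its velocity is carried back along the orbit. *)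
exists (act w (invmx M)).
by rewrite -(tangent_map_act _ (act w (invmx M)) Mu) act_actV// yM.
Qed.

End Factorizations.

(** * Gradients and horizontal vectors *)

Section Gradients.
Context {K : realType} (p1 p2 r : nat).
Local Notation total := ('M[K]_(p1, r) * 'M[K]_(p2, r))%type.
Implicit Types (x y theta eta : total) (X Y : 'M[K]_(p1, p2)) (f : 'M[K]_(p1, p2) -> K).

Definition gradmx f X : 'M[K]_(p1, p2) := \matrix_(i, j) 'D_(delta_mx i j) f X.

Lemma diff_gradmx f X v : differentiable f X -> 'd f X v = frob (gradmx f X) v.
Proof.
move=> df; rewrite {1}(matrix_sum_delta v) linear_sum frobE exchange_big.
apply: eq_bigr => i _; rewrite linear_sum; apply: eq_bigr => j _.
by rewrite linearZ/= mxE deriveE// mulrC.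
Qed.

(** The orthogonal projection G - (1 - P_L) G (1 - P_R) onto the tangent space, arranged so that it
    is visibly a value of the tangent map. *)
Definition tangent_proj x (G : 'M[K]_(p1, p2)) : 'M[K]_(p1, p2) :=
  pj x.1 *m G + (G - pj x.1 *m G) *m pj x.2.

Lemma tangent_map_compl x theta : total_space x ->
  (1%:M - pj x.1) *m tangent_map x theta *m (1%:M - pj x.2) = 0.
Proof.
move=> [x1 x2]; rewrite /tangent_map [(1%:M - pj x.1) *m _]mulmxDr mulmxDl.
rewrite [X in X + _](_ : _ = 0); last first.
  by rewrite mulmxA mulmxBl mul1mx pjK// subrr !mul0mx.
rewrite add0r -!mulmxA [x.2^T *m _]mulmxBr mulmx1 trK_pj// subrr.
by rewrite !mulmx0.
Qed.

Lemma tangent_projP x G : exists theta, tangent_proj x G = tangent_map x theta.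
Proof.
exists ((G - pj x.1 *m G) *m (linv x.2)^T, (linv x.1 *m G)^T).
rewrite /tangent_map /= trmxK /tangent_proj mulmxA; congr (_ + _).
by rewrite -mulmxA -trmx_mul -/(pj x.2) pjT.
Qed.

Lemma frob_tangent_proj x G theta : total_space x ->
  frob (tangent_proj x G) (tangent_map x theta) = frob G (tangent_map x theta).
Proof.
move=> xt; apply/esym/eqP; rewrite -subr_eq0 -frobBl; apply/eqP.
have -> : G - tangent_proj x G = (1%:M - pj x.1) *m G *m (1%:M - pj x.2).
  rewrite [(1%:M - _) *m G]mulmxBl mul1mx [RHS]mulmxBr mulmx1.
  by rewrite /tangent_proj opprD addrA.
have sC n (A : 'M[K]_(n, r)) : (1%:M - pj A)^T = 1%:M - pj A.
  by rewrite linearB/= trmx1 pjT.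
rewrite frobC frob_mulr frob_mull !sC mulmxA.
by rewrite frobC tangent_map_compl// frob0r.
Qed.

Lemma rgrad_embedded f x : total_space x -> differentiable f (product x) ->
  rgrad (embedded_geometry p1 p2 r) f (product x) =
  tangent_proj x (gradmx f (product x)).
Proof.
move=> xt df; apply: xget_unique => /=.
  split; first by apply/tangent_fixed_rank => //; exact: tangent_projP.
  move=> eta /(tangent_fixed_rank _ xt)[theta ->].
  by rewrite diff_gradmx// -/(frob _ _) frob_tangent_proj.
move=> xi [/(tangent_fixed_rank _ xt)[theta xiE] H].
have [th0 pE] := tangent_projP x (gradmx f (product x)).
apply/eqP; rewrite -subr_eq0; apply/eqP/frob_eq0.
rewrite frobBr !frobBl.
have TT t : tangent_space (fixed_rank r) (product x) (tangent_map x t).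
  by apply/tangent_fixed_rank => //; exists t.
have H1 t : frob xi (tangent_map x t) = frob (tangent_proj x (gradmx f (product x))) (tangent_map x t).
  by rewrite frob_tangent_proj// /frob H// diff_gradmx.
have := H1 theta; have := H1 th0; rewrite -xiE -pE => -> ->.
by rewrite !subrr.
Qed.

End Gradients.

(** * Vertical and horizontal vectors *)

Section Horizontal.
Context {K : realType} (p1 p2 r : nat).
Local Notation total := ('M[K]_(p1, r) * 'M[K]_(p2, r))%type.
Implicit Types (x y theta eta : total) (X Y N : 'M[K]_(p1, p2)).
Implicit Types (A M : 'M[K]_r).

(** The product is constant on the fiber, so the tangent map kills a fiber velocity, and the left
    inverses of the factors yield its form. Conversely, acting on [x] by 1 + t A gives a curve with
    the required velocity. *)
Lemma tangent_fiber x v : total_space x ->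
  tangent_space (fiber x) x v <-> exists A, v = (x.1 *m A, - (x.2 *m A^T)).
Proof.
move=> xt; have [x1 x2] := xt; split => [[c [c0 cM dc]]|[A ->]].
  have pc : \forall t \near (0 : K), product x = product (c t).
    by apply: filterS cM => t [M Mu ->]; rewrite product_act.
  have e : tangent_map x v = 0.
    have := near_eq_is_derive pc (is_derive_cst (product x) (0 : K) (1 : K)).
    by move=> [_ <-]; rewrite -{1}c0; case: (is_derive_product dc) => _ <-.
  pose A := - (v.2^T *m (linv x.2)^T).
  have v1 : v.1 = x.1 *m A.
    move: e; rewrite /tangent_map => /(congr1 (mulmx^~ (linv x.2)^T)).
    rewrite mul0mx mulmxDl -!mulmxA -[x.2^T *m _]trmx_mul linvK// trmx1 mulmx1 => /eqP.
    by rewrite addrC addr_eq0 -mulmxN => /eqP.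
  exists A; rewrite [LHS]surjective_pairing v1; congr pair.
  move: e; rewrite /tangent_map v1 -mulmxA -mulmxDr => /(congr1 (mulmx (linv x.1))).
  rewrite mulmx0 mulmxA linvK// mul1mx => /eqP; rewrite addr_eq0 => /eqP e.
  by rewrite -[LHS]trmxK e linearN/= trmx_mul trmxK.
pose B (t : K) : 'M[K]_r := 1%:M + t *: A.
have dB : is_derive (0 : K) (1 : K) B A.
  have := @is_derive_line K 'M[K]_r 'M[K]_r id 1%:M A 0 (C1_at_diff (C1_at_id _)).
  by rewrite derive_id.
have B0 : B 0 = 1%:M by rewrite /B scale0r addr0.
have cB : {for (0 : K), continuous B}.
  by apply: differentiable_continuous; apply/derivable1_diffP; case: dB.
have nB : \forall t \near (0 : K), B t \in unitmx.
  by apply: near_unitmx => //; rewrite B0 unitmx1.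
have dI : differentiable (@adj_inv K r) (B 0).
  apply: C1_at_diff; apply: C1_at_inv_mx; last exact: C1_at_id.
  by rewrite B0 unitmx1.
have dC := is_derive_comp_curve dI dB.
set C := 'd _ _ A in dC.
(* Differentiate B^-1 B = 1 at 0. *)
have CA : C = - A.
  have n1 : \forall t \near (0 : K), 1%:M = adj_inv (B t) *m B t.
    by apply: filterS nB => t Bu; rewrite adj_invE// mulVmx.
  have := near_eq_is_derive n1 (is_derive_cst (1%:M : 'M[K]_r) (0 : K) (1 : K)).
  move=> [_]; case: (is_derive_mulmx dC dB) => _ ->.
  have -> : adj_inv (B 0) = 1%:M by rewrite adj_invE B0 ?unitmx1// invmx1.
  by rewrite B0 mulmx1 mul1mx => /eqP; rewrite addr_eq0 => /eqP.
exists (fun t => (x.1 *m B t, x.2 *m (adj_inv (B t))^T)); split.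
- have -> : adj_inv (B 0) = 1%:M by rewrite adj_invE B0 ?unitmx1// invmx1.
  by rewrite B0 trmx1 !mulmx1; case: (x).
- by apply: filterS nB => t Bu; exists (B t) => //; rewrite adj_invE.
- have D1 := is_derive_mulmx (is_derive_cst x.1 (0 : K) (1 : K)) dB.
  have D2 := is_derive_mulmx (is_derive_cst x.2 (0 : K) (1 : K)) (is_derive_trmx dC).
  have := is_deriveD
    (is_derive_lin_curve (@inl_lin_continuous K 'M[K]_(p1, r) 'M[K]_(p2, r)) D1)
    (is_derive_lin_curve (@inr_lin_continuous K 'M[K]_(p1, r) 'M[K]_(p2, r)) D2).
  rewrite !mul0mx !add0r CA linearN/= mulmxN.
  rewrite (_ : (_, 0) + (0, _) = (x.1 *m A, - (x.2 *m A^T))); last first.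
    by congr pair; rewrite /= ?addr0 ?add0r.
  congr (is_derive _ _ _ _); apply/funext => t.
  by congr pair; rewrite /= ?addr0 ?add0r.
Qed.

Variables W V : total -> 'M[K]_r.
Hypothesis wP : forall x, total_space x -> pos_def (W x) /\ pos_def (V x).

Lemma pos_def_unit n (B : 'M[K]_n) : pos_def B -> B \in unitmx.
Proof.
move=> [sB pB]; rewrite -row_free_unit -kermx_eq0.
apply/negPn/negP => /rowV0Pn[u /sub_kermxP uB u0].
have := pB u^T; rewrite trmxK uB mul0mx mxE ltxx => H.
by apply: (notF (H _)); apply: contra_neq u0 => /(congr1 trmx); rewrite trmxK trmx0.
Qed.

Lemma W_unit x : total_space x -> W x \in unitmx.
Proof. by move=> /wP[/pos_def_unit]. Qed.

Lemma V_unit x : total_space x -> V x \in unitmx.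
Proof. by move=> /wP[_ /pos_def_unit]. Qed.

Lemma W_sym x : total_space x -> (W x)^T = W x.
Proof. by move=> /wP[[]]. Qed.

Lemma V_sym x : total_space x -> (V x)^T = V x.
Proof. by move=> /wP[_ []]. Qed.

(** The trace is the sum of the values of the form [B] on the rows of [u]. *)
Lemma trace_pos_def n m (B : 'M[K]_n) (u : 'M[K]_(m, n)) : pos_def B ->
  0 <= \tr (B *m u^T *m u) /\ (\tr (B *m u^T *m u) = 0 -> u = 0).
Proof.
move=> [sB pB].
have -> : \tr (B *m u^T *m u) = \sum_i (row i u *m B *m (row i u)^T) 0 0.
  rewrite -mulmxA mxtrace_mulC -mulmxA mxtrace_mulC.
  rewrite -[X in \tr X]trmxK mxtrace_tr !trmx_mul trmxK sB mulmxA.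
  apply: eq_bigr => i _; rewrite -row_mul [LHS]mxE dot_rV.
  by apply: eq_bigr => k _; rewrite !mxE.
have q0 i : 0 <= (row i u *m B *m (row i u)^T) 0 0.
  have [->|u0] := eqVneq (row i u) 0; first by rewrite !mul0mx mxE.
  rewrite ltW// -{1}[row i u]trmxK; apply: pB.
  by apply: contra_neq u0 => /(congr1 trmx); rewrite trmxK trmx0.
split; first by apply: sumr_ge0.
move=> /(psumr_eq0P (fun i _ => q0 i)) H; apply/row_matrixP => i; rewrite row0.
apply/eqP/negPn/negP => u0; have := H i isT; apply/eqP; rewrite gt_eqF//.
rewrite -{1}[row i u]trmxK; apply: pB.
by apply: contra_neq u0 => /(congr1 trmx); rewrite trmxK trmx0.
Qed.

Lemma total_metricP x c u v w :
  total_metric W V x (c *: u + v) w =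
  c * total_metric W V x u w + total_metric W V x v w.
Proof.
have trP m n (A B : 'M[K]_(m, n)) : (c *: A + B)^T = c *: A^T + B^T.
  exact: linearP.
rewrite /total_metric/= !trP !mulmxDr !mulmxDl -!scalemxAr -!scalemxAl.
by rewrite !mxtraceD !mxtraceZ mulrDr addrACA.
Qed.

Lemma total_metricC x u v : total_space x ->
  total_metric W V x u v = total_metric W V x v u.
Proof.
move=> xt; rewrite /total_metric; congr (_ + _).
  rewrite -mxtrace_tr !trmx_mul trmxK (W_sym xt) mulmxA mxtrace_mulC.
  by rewrite mulmxA.
rewrite -mxtrace_tr !trmx_mul trmxK (V_sym xt) mulmxA mxtrace_mulC.
by rewrite mulmxA.
Qed.

Lemma total_metric_gt0 x u : total_space x -> u != 0 -> 0 < total_metric W V x u u.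
Proof.
move=> /wP[pW pV] u0; have [a1 b1] := trace_pos_def u.1 pW.
have [a2 b2] := trace_pos_def u.2 pV.
rewrite lt0r addr_ge0// andbT; apply: contra_neq u0 => /eqP.
rewrite paddr_eq0// => /andP[/eqP/b1 e1 /eqP/b2 e2].
by rewrite [LHS]surjective_pairing e1 e2.
Qed.

(** Pairing [theta] with the vertical vector of A gives the Frobenius product of A with the defect
    of this equation; choosing A to be the defect itself forces the equation. *)
Lemma horizontalP x theta : total_space x ->
  horizontal W V x theta <->
  x.1^T *m theta.1 *m W x = V x *m theta.2^T *m x.2.
Proof.
move=> xt; have key A : total_metric W V x (x.1 *m A, - (x.2 *m A^T)) theta =
    frob A (x.1^T *m theta.1 *m W x - V x *m theta.2^T *m x.2).
  rewrite frobBr /total_metric/= /frob linearN/= mulmxN mulNmx linearN/=.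
  congr (_ - _).
    by rewrite trmx_mul -!mulmxA mxtrace_mulC !mulmxA.
  rewrite -mxtrace_tr !trmx_mul !trmxK (V_sym xt).
  have -> : A^T *m (V x *m theta.2^T *m x.2) = (A^T *m V x) *m (theta.2^T *m x.2).
    by rewrite !mulmxA.
  by rewrite [RHS]mxtrace_mulC !mulmxA.
split=> [H|H eta /(tangent_fiber _ xt)[A ->]]; last first.
  by rewrite key H subrr frob0r.
apply/eqP; rewrite -subr_eq0; apply/eqP/frob_eq0; rewrite -key; apply: H.
by apply/tangent_fiber => //; eexists.
Qed.

Definition hfield N y : total :=
  (N *m y.2 *m invmx (W y), N^T *m y.1 *m invmx (V y)).

Lemma hfield_horizontal N x : total_space x -> horizontal W V x (hfield N x).
Proof.
move=> xt; apply/horizontalP => //; rewrite /hfield/= !trmx_mul trmxK.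
rewrite trmx_inv (V_sym xt) !mulmxA mulmxV ?V_unit// mul1mx.
by rewrite -!mulmxA mulVmx ?W_unit// mulmx1.
Qed.

Lemma hfield_metric N x eta : total_space x ->
  total_metric W V x (hfield N x) eta = frob N (tangent_map x eta).
Proof.
move=> xt; rewrite /total_metric /tangent_map frobDr addrC /hfield/=.
have eW : W x *m (N *m x.2 *m invmx (W x))^T = x.2^T *m N^T.
  by rewrite !trmx_mul trmx_inv (W_sym xt) mulKVmx ?W_unit.
have eV : V x *m (N^T *m x.1 *m invmx (V x))^T = x.1^T *m N.
  by rewrite !trmx_mul trmx_inv (V_sym xt) mulKVmx ?V_unit// trmxK.
rewrite eW eV -(mulmxA x.2^T) -(mulmxA x.1^T); congr (_ + _).
  by rewrite -frob_tr trmx_mul trmxK mxtrace_mulC /frob trmxK mulmxA.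
by rewrite mxtrace_mulC /frob mulmxA.
Qed.

(** [N] must solve N R = theta_L W and L^T N = V theta_R^T. The two equations agree on L^T N R
    exactly when [theta] is horizontal. *)
Lemma horizontal_hfield x theta : total_space x -> horizontal W V x theta ->
  exists N, theta = hfield N x.
Proof.
move=> xt /(horizontalP _ xt) H; have [x1 x2] := xt.
(* The first term solves the equation for N R; the factor 1 - P_R lets the second term repair L^T N
   without disturbing it. *)
pose N := theta.1 *m W x *m linv x.2 +
  (linv x.1)^T *m V x *m theta.2^T *m (1%:M - pj x.2).
have N2 : N *m x.2 = theta.1 *m W x.
  rewrite /N mulmxDl -(mulmxA _ (linv _)) linvK// mulmx1.
  by rewrite -(mulmxA _ (1%:M - _)) mulmxBl mul1mx pjK// subrr mulmx0 addr0.
have N1 : N^T *m x.1 = theta.2 *m V x.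
  have e1 : x.1^T *m (theta.1 *m W x *m linv x.2) = V x *m theta.2^T *m pj x.2.
    by rewrite !mulmxA H -(mulmxA _ x.2).
  have e2 : x.1^T *m ((linv x.1)^T *m V x *m theta.2^T *m (1%:M - pj x.2)) =
      V x *m theta.2^T *m (1%:M - pj x.2).
    by rewrite !(mulmxA x.1^T) -[x.1^T *m (linv x.1)^T]trmx_mul linvK// trmx1 mul1mx.
  have : x.1^T *m N = V x *m theta.2^T.
    by rewrite /N [x.1^T *m _]mulmxDr e1 e2 mulmxBr mulmx1 addrC subrK.
  by move=> /(congr1 trmx); rewrite !trmx_mul !trmxK (V_sym xt).
exists N; rewrite /hfield N1 N2 !mulmxK ?V_unit ?W_unit//.
exact: surjective_pairing.
Qed.

Lemma lifted_diff (f : 'M[K]_(p1, p2) -> K) x eta : differentiable f (product x) ->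
  'd (lifted_objective f : total -> K) x eta = 'd f (product x) (tangent_map x eta).
Proof.
move=> df.
have dp : differentiable (@product K p1 p2 r) x.
  by apply: C1_at_diff; apply: C1_at_product; exact: C1_at_id.
have -> : lifted_objective f = f \o @product K p1 p2 r by [].
rewrite diff_comp//=; congr ('d f _ _).
have dl := @is_derive_line K total total id x eta 0 (C1_at_diff (C1_at_id _)).
rewrite derive_id in dl.
have dp' : differentiable (@product K p1 p2 r) ((fun s : K => x + s *: eta) 0).
  by rewrite /= scale0r addr0.
have [_] := is_derive_comp_curve dp' dl.
rewrite /= scale0r addr0 => <-.
by case: (tangent_map_curve x eta) => _ ->.
Qed.

Lemma rgrad_quotient (f : 'M[K]_(p1, p2) -> K) x :
  total_space x -> differentiable f (product x) ->
  rgrad (quotient_geometry W V) (lifted_objective f) x =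
  hfield (rgrad (embedded_geometry p1 p2 r) f (product x)) x.
Proof.
move=> xt df; set g := rgrad _ f _.
have gE eta : frob g (tangent_map x eta) = 'd (lifted_objective f : total -> K) x eta.
  by rewrite /g rgrad_embedded// frob_tangent_proj// lifted_diff// diff_gradmx.
apply: xget_unique => /=.
  split; first exact: hfield_horizontal.
  by move=> eta _; rewrite hfield_metric// gE.
move=> xi [xiH H].
apply/eqP; rewrite -subr_eq0; apply: contraT => /(total_metric_gt0 xt).
have d0 eta : horizontal W V x eta -> total_metric W V x (xi - hfield g x) eta = 0.
  move=> eH; rewrite addrC -scaleN1r total_metricP H// hfield_metric// gE.
  by rewrite mulN1r addNr.
(* Both candidates are horizontal, so their difference may be tested against itself. *)
rewrite d0 ?ltxx//; apply/horizontalP => //.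
have /(horizontalP _ xt) h1 := xiH.
have /(horizontalP _ xt) h2 := hfield_horizontal g xt.
set u := hfield g x in h2 *; have -> : (xi - u).1 = xi.1 - u.1 by [].
have -> : (xi - u).2^T = xi.2^T - u.2^T by exact: linearB.
by rewrite !mulmxBr !mulmxBl h1 h2.
Qed.

End Horizontal.

(** * Continuously differentiable vector fields *)

Section Fields.
Context {K : realType} (p1 p2 r : nat).
Local Notation total := ('M[K]_(p1, r) * 'M[K]_(p2, r))%type.
Implicit Types (x y : total) (X Y N : 'M[K]_(p1, p2)).

Lemma has_frame_total : has_frame total.
Proof. by apply: has_frame_pair; exact: has_frame_mx. Qed.

Lemma near_sec x : total_space x -> \forall Y \near product x, \rank Y = r ->
  total_space (sec x Y) /\ product (sec x Y) = Y.
Proof.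
move=> xt; apply: filterS (near_sec_unit xt) => Y Nu rY.
by split; [exact: sec_total|exact: product_sec].
Qed.

Lemma C1_at_gradmx (f : 'M[K]_(p1, p2) -> K) X : Ck 2 setT f -> C1_at (gradmx f) X.
Proof.
move=> [_ cf]; apply: C1_at_mx => i j.
rewrite [X in C1_at X _](_ : _ = 'D_(delta_mx i j) f); last first.
  by apply/funext => Y; rewrite mxE.
exact: Ck_C1_atT (cf _).
Qed.

Definition smooth_pj p (A : 'M[K]_(p, r)) : 'M[K]_p :=
  A *m (adj_inv (A^T *m A) *m A^T).

Lemma smooth_pjE p (A : 'M[K]_(p, r)) : \rank A = r -> smooth_pj A = pj A.
Proof. by move=> rA; rewrite /smooth_pj adj_invE// gram_unit. Qed.

Lemma C1_at_smooth_pj (E : normedModType K) p (A : E -> 'M[K]_(p, r)) (e : E) :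
  C1_at A e -> \rank (A e) = r -> C1_at (fun z => smooth_pj (A z)) e.
Proof.
move=> cA rA; have cAT := C1_at_trmx cA.
apply: C1_at_mulmx; [exact: cA|apply: C1_at_mulmx; last exact: cAT].
apply: C1_at_inv_mx; first exact: gram_unit.
by apply: C1_at_mulmx; [exact: cAT|exact: cA].
Qed.

(** The projection formula depends on a factorization of the point. [sec] provides one that is C^1
    on an open set of matrices, hence a C^1 extension of the gradient. *)
Lemma rgrad_embedded_field (f : 'M[K]_(p1, p2) -> K) : Ck 2 setT f ->
  fields (embedded_geometry p1 p2 r) (rgrad (embedded_geometry p1 p2 r) f).
Proof.
move=> Cf; have df X : differentiable f X by exact: Cf.1.
split=> [|X /rank_factor[x xt <-]]; last first.
  apply/tangent_fixed_rank => //; rewrite rgrad_embedded//.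
  by have [th ->] := tangent_projP x (gradmx f (product x)); exists th.
apply: Ck_on1I => X /rank_factor[x xt <-].
have cs : C1_at (sec x) (product x) by apply: C1_at_sec; exact: sec_unit.
have [[s1 s2] _] := nbhs_singleton (near_sec xt) (product_rank xt).
have cG : C1_at (gradmx f) (product x) by exact: C1_at_gradmx.
have c1 : C1_at (fun Y => smooth_pj (sec x Y).1) (product x).
  by apply: C1_at_smooth_pj => //; exact: C1_at_fst.
have c2 : C1_at (fun Y => smooth_pj (sec x Y).2) (product x).
  by apply: C1_at_smooth_pj => //; exact: C1_at_snd.
exists (fun Y => smooth_pj (sec x Y).1 *m gradmx f Y +
   (gradmx f Y - smooth_pj (sec x Y).1 *m gradmx f Y) *m smooth_pj (sec x Y).2).
  apply: C1_at_add; first exact: C1_at_mulmx.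
  apply: C1_at_mulmx; last exact: c2.
  by apply: C1_at_sub; [exact: cG|exact: C1_at_mulmx].
apply: filterS (near_sec xt) => Y HY rY; have [st sp] := HY rY.
have -> : rgrad (embedded_geometry p1 p2 r) f Y =
    tangent_proj (sec x Y) (gradmx f Y).
  by have := rgrad_embedded st (df _); rewrite sp.
by case: st => st1 st2; rewrite /tangent_proj !smooth_pjE.
Qed.

Variables W V : total -> 'M[K]_r.
Hypothesis wt : weights W V.
Hypothesis winv : weights_invariant W V.

Let wP : forall x, total_space x -> pos_def (W x) /\ pos_def (V x).
Proof. by case: wt. Qed.

Lemma weights_inv x M : total_space x -> M \in unitmx ->
  invmx (W x) = invmx M^T *m invmx (W (act x M)) *m invmx M /\
  invmx (V x) = M *m invmx (V (act x M)) *m M^T.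
Proof.
move=> xt Mu; have xt' := act_total Mu xt.
have Wu := W_unit wP xt'; have Vu := V_unit wP xt'.
have [eW eV] := winv xt Mu; split.
  rewrite -[RHS](mulmxK (W_unit wP xt)) {2}eW !mulmxA.
  by rewrite (mulmxKV Mu) (mulmxKV Wu) mulVmx ?unitmx_tr// mul1mx.
rewrite -[RHS](mulmxK (V_unit wP xt)) {2}eV !mulmxA.
rewrite -(mulmxA _ M^T) -trmx_mul mulVmx// trmx1 mulmx1 (mulmxKV Vu).
by rewrite mulmxV// mul1mx.
Qed.

Lemma hfield_act N x M : total_space x -> M \in unitmx ->
  hfield W V N (act x M) = act (hfield W V N x) M.
Proof.
move=> xt Mu; have [iW iV] := weights_inv xt Mu.
rewrite /hfield [RHS]/act/= iW iV; congr pair; rewrite !mulmxA.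
  by rewrite (mulmxKV Mu) trmx_inv.
by rewrite -(mulmxA _ M^T) -trmx_mul mulVmx// trmx1 mulmx1.
Qed.

(** The weights and [F] have only local C^1 extensions, so the horizontal field too gets a local
    representative. It serves for the regularity of the field, for its image under the tangent map
    and for differentiation along lines. *)
Lemma hfield_local (F : 'M[K]_(p1, p2) -> 'M[K]_(p1, p2)) x :
  Ck_on 1 (fixed_rank r) F -> total_space x ->
  exists2 G : total -> total, C1_at G x & \forall y \near x, total_space y ->
    hfield W V (F (product y)) y = G y.
Proof.
move=> cF xt; case: wt => cW cV _.
have [gW cgW nW] := Ck_on1E (cW 1%N) xt.
have [gV cgV nV] := Ck_on1E (cV 1%N) xt.
have [gF cgF nF] := Ck_on1E cF (product_rank xt).
have gWu : gW x \in unitmx by rewrite -(nbhs_singleton nW xt); exact: (W_unit wP).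
have gVu : gV x \in unitmx by rewrite -(nbhs_singleton nV xt); exact: (V_unit wP).
have cp : C1_at (@product K p1 p2 r) x by apply: C1_at_product; exact: C1_at_id.
have cgFp : C1_at (fun y => gF (product y)) x.
  by apply: C1_at_comp; [exact: has_frame_mx|exact: cp|exact: cgF].
exists (fun y => (gF (product y) *m y.2 *m adj_inv (gW y),
   (gF (product y))^T *m y.1 *m adj_inv (gV y))).
  apply: C1_at_pair; apply: C1_at_mulmx.
  - apply: C1_at_mulmx; first exact: cgFp.
    by apply: C1_at_snd; exact: C1_at_id.
  - exact: C1_at_inv_mx.
  - apply: C1_at_mulmx; first exact: C1_at_trmx.
    by apply: C1_at_fst; exact: C1_at_id.
  - exact: C1_at_inv_mx.
have nF' : \forall y \near x, \rank (product y) = r -> F (product y) = gF (product y).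
  exact: (C1_at_cont cp) _ nF.
apply: filterS3 nW nV nF' => y eW eV eF yt.
rewrite /hfield eF ?product_rank//.
by rewrite -eW// -eV// !adj_invE//; [exact: V_unit wP _ yt|exact: W_unit wP _ yt].
Qed.

Lemma hfield_field (F : 'M[K]_(p1, p2) -> 'M[K]_(p1, p2)) :
  Ck_on 1 (fixed_rank r) F ->
  fields (quotient_geometry W V) (fun y => hfield W V (F (product y)) y).
Proof.
move=> cF; split.
- by apply: Ck_on1I => x xt; exact: hfield_local.
- by move=> x xt; exact: (hfield_horizontal wP).
- by move=> x M xt Mu; rewrite product_act// hfield_act.
Qed.

Lemma Ck_on1_cst (E F : normedModType K) (S : set E) (c : F) :
  Ck_on 1 S (fun _ : E => c).
Proof.
apply: Ck_on1I => e _; exists (cst c); first exact: C1_at_cst.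
exact: nearW.
Qed.

Lemma Ck_on1_ext (E F : normedModType K) (S : set E) (f g : E -> F) :
  (forall e, S e -> f e = g e) -> Ck_on 1 S f -> Ck_on 1 S g.
Proof.
move=> fg cf; apply: Ck_on1I => e Se; have [h ch nh] := Ck_on1E cf Se.
by exists h => //; apply: filterS nh => z H Sz; rewrite -fg// H.
Qed.

Lemma rgrad_quotient_field (f : 'M[K]_(p1, p2) -> K) : Ck 2 setT f ->
  fields (quotient_geometry W V) (rgrad (quotient_geometry W V) (lifted_objective f)).
Proof.
move=> Cf; have df X : differentiable f X by exact: Cf.1.
have [cg _] := rgrad_embedded_field Cf; have [c h e] := hfield_field cg.
have E x : total_space x -> rgrad (quotient_geometry W V) (lifted_objective f) x =
    hfield W V (rgrad (embedded_geometry p1 p2 r) f (product x)) x.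
  by move=> xt; rewrite (rgrad_quotient wP).
split.
- by apply: Ck_on1_ext c => x xt; rewrite E.
- by move=> x xt; rewrite E//; exact: h.
- by move=> x M xt Mu; rewrite !E//; [exact: e|exact: act_total].
Qed.

(* The field that a horizontal field [hfield N] induces on the matrices of rank
   [r]; it does not depend on the factorization that is picked. *)
Definition push N X : 'M[K]_(p1, p2) :=
  let x := xget 0 [set x : total | total_space x /\ product x = X] in
  tangent_map x (hfield W V N x).

Lemma push_product N x : total_space x ->
  push N (product x) = tangent_map x (hfield W V N x).
Proof.
move=> xt; rewrite /push; case: xgetP => [y _ [yt yx]|/(_ x)[]//].
have [M Mu ->] := factor_act xt yt (esym yx).
by rewrite hfield_act// tangent_map_act.
Qed.

(** [sec] supplies a factorization that is C^1 in the matrix, and [push_product] allows computing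
    with it. *)
Lemma push_field N : fields (embedded_geometry p1 p2 r) (push N).
Proof.
split=> [|X /rank_factor[x xt <-]]; last first.
  by apply/tangent_fixed_rank => //; rewrite push_product//; eexists.
apply: Ck_on1I => X /rank_factor[x xt <-].
have cs : C1_at (sec x) (product x) by apply: C1_at_sec; exact: sec_unit.
have [st _] := nbhs_singleton (near_sec xt) (product_rank xt).
have [G cG nG] := hfield_local (@Ck_on1_cst _ _ (fixed_rank r) N) st.
have cGs : C1_at (fun Y => G (sec x Y)) (product x).
  by apply: C1_at_comp; [exact: has_frame_total|exact: cs|exact: cG].
exists (fun Y => tangent_map (sec x Y) (G (sec x Y))).
  apply: C1_at_add; apply: C1_at_mulmx.
  - exact: C1_at_fst.
  - by apply: C1_at_trmx; exact: C1_at_snd.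
  - exact: C1_at_fst.
  - by apply: C1_at_trmx; exact: C1_at_snd.
have nG' : \forall Y \near product x, total_space (sec x Y) ->
    hfield W V N (sec x Y) = G (sec x Y).
  exact: (C1_at_cont cs) _ nG.
apply: filterS2 (near_sec xt) nG' => Y H1 H2 rY.
by have [sY pY] := H1 rY; rewrite -H2// -push_product// pY.
Qed.

End Fields.

(** * Hessians at a stationary point *)

Section Hessians.
Context {K : realType} (p1 p2 r : nat).
Local Notation total := ('M[K]_(p1, r) * 'M[K]_(p2, r))%type.
Implicit Types (x y xi theta : total) (X Y N : 'M[K]_(p1, p2)).
Variables (f : 'M[K]_(p1, p2) -> K) (W V : total -> 'M[K]_r) (x : total).
Hypothesis Cf : Ck 2 setT f.
Hypothesis wt : weights W V.
Hypothesis winv : weights_invariant W V.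
Hypothesis xt : total_space x.

Local Notation Me := (embedded_geometry p1 p2 r).
Local Notation Mq := (quotient_geometry W V).
Local Notation h := (lifted_objective f).

Let wP : forall x, total_space x -> pos_def (W x) /\ pos_def (V x).
Proof. by case: wt. Qed.

Let df X : differentiable f X. Proof. exact: Cf.1. Qed.

(** With g = grad f, the formula for grad h turns the right side into g P_R + P_L g (1 - P_R). This
    is g because tangency means (1 - P_L) g (1 - P_R) = 0. *)
Lemma rgrad_embedded_quotient :
  rgrad Me f (product x) =
    (rgrad Mq h x).1 *m W x *m linv x.2 +
    ((rgrad Mq h x).2 *m V x *m linv x.1)^T *m (1%:M - pj x.2).
Proof.
rewrite (rgrad_quotient wP)// /hfield/=; have [x1 x2] := xt.
rewrite !mulmxKV ?(V_unit wP)// ?(W_unit wP)//.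
set g := rgrad _ _ _; rewrite -!mulmxA -/(pj x.2) -/(pj x.1) trmx_mul pjT trmxK.
have [th gE] : exists th, g = tangent_map x th.
  by rewrite /g rgrad_embedded//; exact: tangent_projP.
have := tangent_map_compl th xt; rewrite -gE mulmxBl mul1mx mulmxBl => /eqP.
by rewrite subr_eq0 mulmxBr mulmx1 -mulmxA => /eqP <-; rewrite addrC subrK.
Qed.

Lemma is_derive_frob m n (A B : K -> 'M[K]_(m, n)) (t : K) dA dB :
  is_derive t (1 : K) A dA -> is_derive t (1 : K) B dB ->
  is_derive t (1 : K) (fun s => frob (A s) (B s)) (frob dA (B t) + frob (A t) dB).
Proof.
move=> hA hB.
have := is_derive_mxtrace (is_derive_mulmx (is_derive_trmx hA) hB).
by rewrite mxtraceD.
Qed.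

Lemma line_curve xi : is_derive (0 : K) (1 : K) (fun t : K => x + t *: xi) xi.
Proof.
have := @is_derive_line K total total id x xi 0 (C1_at_diff (C1_at_id _)).
by rewrite derive_id.
Qed.

Lemma near_line (P : set total) xi : nbhs x P ->
  \forall t \near (0 : K), P (x + t *: xi).
Proof.
move=> nP.
have cl : {for (0 : K), continuous (fun t : K => x + t *: xi)}.
  apply: differentiable_continuous; apply/derivable1_diffP.
  by case: (line_curve xi).
have n : nbhs (x + (0 : K) *: xi) P by rewrite scale0r addr0.
exact: (cl _ n).
Qed.

Lemma line_total_space xi : curve_at (@total_space K p1 p2 r) x xi (fun t => x + t *: xi).
Proof.
split; first by rewrite scale0r addr0.
- exact/near_line/near_total_space.
- exact: line_curve.
Qed.

Lemma line_fixed_rank xi : curve_at (fixed_rank r) (product x) (tangent_map x xi)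
  (fun t => product (x + t *: xi)).
Proof.
split; first by rewrite scale0r addr0.
- by apply: filterS (near_line xi (near_total_space xt)) => t; exact: product_rank.
- exact: tangent_map_curve.
Qed.

Definition second_form (v w : 'M[K]_(p1, p2)) : K :=
  frob ('d (gradmx f) (product x) v) w.

Lemma second_formC v w : second_form v w = second_form w v.
Proof.
have H a b : second_form a b = 'D_a ('D_b f) (product x).
  have dl : is_derive (0 : K) (1 : K) (fun t : K => product x + t *: a) a.
    have := @is_derive_line K _ _ id (product x) a 0 (C1_at_diff (C1_at_id _)).
    by rewrite derive_id.
  have dG : differentiable (gradmx f) ((fun t : K => product x + t *: a) 0).
    exact: C1_at_diff (C1_at_gradmx _ Cf).
  have D1 := is_derive_frob (is_derive_comp_curve dG dl)
    (is_derive_cst b (0 : K) (1 : K)).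
  have dD : differentiable ('D_b f) (product x + (0 : K) *: a) by apply: (Cf.2 b).1.
  have D2 := is_derive_line dD.
  have E : (fun t : K => frob (gradmx f (product x + t *: a)) b) =
           (fun t : K => 'D_b f (product x + t *: a)).
    by apply/funext => t; rewrite deriveE// diff_gradmx.
  move: D1; rewrite E => -[_]; case: D2 => _ ->.
  by rewrite frob0r addr0 !scale0r !addr0.
by rewrite !H second_derivative_sym.
Qed.

Hypothesis crit : rgrad Mq h x = 0.

Lemma crit_embedded : rgrad Me f (product x) = 0.
Proof.
by rewrite rgrad_embedded_quotient crit/= !mul0mx trmx0 mul0mx addr0.
Qed.

Variables (nabla_e : 'M[K]_(p1, p2) -> 'M[K]_(p1, p2) ->
    ('M[K]_(p1, p2) -> 'M[K]_(p1, p2)) -> 'M[K]_(p1, p2))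
  (nabla_q : total -> total -> (total -> total) -> total).
Hypothesis lce : levi_civita Me nabla_e.
Hypothesis lcq : levi_civita Mq nabla_q.

(** The derivative of [f] along [push N] at points of the projected line. By [hfield_metric] it is
    also the metric pairing of grad h with the horizontal field of N. *)
Let pairing N xi (t : K) : K :=
  frob (rgrad Me f (product (x + t *: xi))) (push W V N (product (x + t *: xi))).

Lemma rhess_embedded_pairing N xi :
  rhess_form Me nabla_e f (product x) (tangent_map x xi)
    (tangent_map x (hfield W V N x)) = 'D_1 (pairing N xi) 0.
Proof.
have Txi : tangent_space (fixed_rank r) (product x) (tangent_map x xi).
  by apply/tangent_fixed_rank => //; exists xi.
have := lc_metric lce (product_rank xt) Txi (rgrad_embedded_field r Cf)
  (push_field wt winv N) (line_fixed_rank xi).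
rewrite /= crit_embedded trmx0 mul0mx mxtrace0 addr0 push_product// => <-.
Qed.

Lemma rhess_quotient_pairing N xi : horizontal W V x xi ->
  rhess_form Mq nabla_q h x xi (hfield W V N x) = 'D_1 (pairing N xi) 0.
Proof.
move=> xiH.
have := lc_metric lcq xt xiH (rgrad_quotient_field wt winv Cf)
  (hfield_field wt winv (@Ck_on1_cst _ _ _ (fixed_rank r) N)) (line_total_space xi).
rewrite /= crit.
have -> : total_metric W V x 0 (nabla_q x xi (fun y => hfield W V N y)) = 0.
  by rewrite /total_metric/= !trmx0 !mulmx0 !mul0mx mxtrace0 addr0.
rewrite addr0 => <-; apply: near_eq_derive.
apply: filterS (near_line xi (near_total_space xt)) => t yt.
by rewrite /pairing push_product// (rgrad_quotient wP)// hfield_metric.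
Qed.

Lemma rhess_quotient_embedded xi theta :
  horizontal W V x xi -> horizontal W V x theta ->
  rhess_form Mq nabla_q h x xi theta =
  rhess_form Me nabla_e f (product x) (tangent_map x xi) (tangent_map x theta).
Proof.
move=> xiH /(horizontal_hfield wP xt)[N ->].
by rewrite rhess_quotient_pairing// rhess_embedded_pairing.
Qed.

(** This form makes symmetry visible. Against tangent vectors the Euclidean gradient may replace
    grad f, and the product rule then leaves the second derivative of [f], a symmetric bilinear
    term, and one term with the derivative [z] of the field. *)
Lemma rhess_quotientE xi theta : horizontal W V x xi -> horizontal W V x theta ->
  rhess_form Mq nabla_q h x xi theta =
    second_form (tangent_map x xi) (tangent_map x theta) +
    frob (gradmx f (product x)) (xi.1 *m theta.2^T + theta.1 *m xi.2^T).
Proof.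
move=> xiH /(horizontal_hfield wP xt)[N ->]; rewrite rhess_quotient_pairing//.
set th := hfield _ _ _ _.
have nE : \forall t \near (0 : K), frob (gradmx f (product (x + t *: xi)))
    (tangent_map (x + t *: xi) (hfield W V N (x + t *: xi))) = pairing N xi t.
  apply: filterS (near_line xi (near_total_space xt)) => t yt.
  by rewrite /pairing push_product// rgrad_embedded// frob_tangent_proj.
rewrite -(near_eq_derive _ nE).
have dc := line_curve xi.
have [G cG nG] := hfield_local wt (@Ck_on1_cst _ _ _ (fixed_rank r) N) xt.
have dG : differentiable G ((fun t : K => x + t *: xi) 0).
  by rewrite /= scale0r addr0; exact: C1_at_diff.
have dY : is_derive (0 : K) (1 : K) (fun t : K => hfield W V N (x + t *: xi))
    ('d G ((fun t : K => x + t *: xi) 0) xi).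
  apply: near_eq_is_derive (is_derive_comp_curve dG dc).
  have nG' : nbhs x [set y | G y = hfield W V N y].
    by apply: filterS2 nG (near_total_space xt) => y H /H.
  exact: (near_line xi nG').
set z := 'd G _ xi in dY.
have f1 := @fst_lin_continuous K 'M[K]_(p1, r) 'M[K]_(p2, r).
have f2 := @snd_lin_continuous K 'M[K]_(p1, r) 'M[K]_(p2, r).
have DT := is_deriveD
  (is_derive_mulmx (is_derive_lin_curve f1 dc)
     (is_derive_trmx (is_derive_lin_curve f2 dY)))
  (is_derive_mulmx (is_derive_lin_curve f1 dY)
     (is_derive_trmx (is_derive_lin_curve f2 dc))).
have dgm : differentiable (gradmx f) ((fun t : K => product (x + t *: xi)) 0).
  exact: C1_at_diff (C1_at_gradmx _ Cf).
have DG := is_derive_comp_curve dgm (tangent_map_curve x xi).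
case: (is_derive_frob DG DT) => _ ->.
(* At a critical point the Euclidean gradient is normal to the fixed-rank matrices, so [z]
   contributes nothing. *)
have ez : frob (gradmx f (product x)) (tangent_map x z) = 0.
  rewrite -(frob_tangent_proj _ _ xt) -rgrad_embedded// crit_embedded.
  by rewrite frobC frob0r.
have E2 : xi.1 *m th.2^T + x.1 *m z.2^T + (z.1 *m x.2^T + th.1 *m xi.2^T) =
    xi.1 *m th.2^T + th.1 *m xi.2^T + tangent_map x z.
  by rewrite /tangent_map [z.1 *m _ + _]addrC addrACA.
pose x' := x + (0 : K) *: xi; pose th' := hfield W V N x'.
transitivity (frob ('d (gradmx f) (product x') (tangent_map x xi)) (tangent_map x' th') +
  frob (gradmx f (product x')) (xi.1 *m th'.2^T + x'.1 *m z.2^T +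
    (z.1 *m x'.2^T + th'.1 *m xi.2^T))); first by [].
have x'E : x' = x by rewrite /x' scale0r addr0.
by rewrite /th' x'E E2 [X in _ + X]frobDr ez addr0.
Qed.

Lemma rhess_quotientC xi theta : horizontal W V x xi -> horizontal W V x theta ->
  rhess_form Mq nabla_q h x xi theta = rhess_form Mq nabla_q h x theta xi.
Proof.
move=> xiH thH; rewrite !rhess_quotientE// second_formC; congr (_ + _).
by rewrite addrC.
Qed.

End Hessians.

(** * Bounds on the differential of the quotient map *)

Section Bounds.
Context {K : realType}.

Lemma pos_def_congr n (B P : 'M[K]_n) : pos_def B -> P \in unitmx ->
  pos_def (P *m B *m P^T).
Proof.
move=> [sB pB] Pu; split; first by rewrite !trmx_mul trmxK sB mulmxA.
move=> u u0; have -> : u^T *m (P *m B *m P^T) *m u = (P^T *m u)^T *m B *m (P^T *m u).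
  by rewrite trmx_mul trmxK !mulmxA.
apply: pB; apply: contra_neq u0 => e.
by rewrite -[u](mulKmx (_ : P^T \in unitmx)) ?unitmx_tr// e mulmx0.
Qed.

Lemma pos_def_inv n (B : 'M[K]_n) : pos_def B -> pos_def (invmx B).
Proof.
move=> pB; have Bu := pos_def_unit pB; case: (pB) => sB _.
have := @pos_def_congr _ _ (invmx B) pB.
by rewrite unitmx_inv Bu mulVmx// mul1mx trmx_inv sB; apply.
Qed.

Lemma pos_def_sqrt n (B : 'M[K]_n) : pos_def B -> exists S : 'M[K]_n, B = S *m S^T.
Proof.
move=> /pos_def_spectral[Q [d [_ -> d0 _ _]]].
exists (Q^T *m diag_mx (\row_i Num.sqrt (d 0 i))).
rewrite [in RHS]trmx_mul trmxK tr_diag_mx !mulmxA; congr (_ *m _).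
rewrite -[RHS]mulmxA mulmx_diag; congr (_ *m diag_mx _); apply/rowP => i.
by rewrite !mxE -expr2 sqr_sqrtr// ltW.
Qed.

Lemma frob_diag m n (Z : 'M[K]_(m, n)) (d : 'rV[K]_n) :
  frob Z (Z *m diag_mx d) = \sum_j d 0 j * \sum_i Z i j ^+ 2.
Proof.
rewrite frobE; apply: eq_bigr => j _; rewrite mulr_sumr; apply: eq_bigr => i _.
by rewrite mul_mx_diag mxE expr2; ring.
Qed.

(** In an eigenbasis of [A] the columns Z_j of N U Q^T decouple: <N, B> is the sum of d_j |Z_j|^2
    and |B|^2 the sum of d_j^2 |Z_j|^2. *)
Lemma psd_bounds m n r (N : 'M[K]_(m, n)) (U : 'M[K]_(n, r.+1)) (A : 'M[K]_r.+1) :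
  U^T *m U = 1%:M -> pos_def A ->
  let B := N *m (U *m A *m U^T) in
  [/\ 0 <= frob N B, sigma r.+1 A * frob N B <= frob B B &
      frob B B <= sigma 1 A * frob N B].
Proof.
move=> UU /pos_def_spectral[Q [d [QQ AE d0 sd sg]]].
have [Z ZE] : exists Z, Z = N *m U *m Q^T by exists (N *m U *m Q^T).
have BE : N *m (U *m A *m U^T) = Z *m diag_mx d *m (Q *m U^T).
  by rewrite AE ZE !mulmxA.
have NB : frob N (N *m (U *m A *m U^T)) = \sum_j d 0 j * \sum_i Z i j ^+ 2.
  rewrite BE frob_mulr trmx_mul trmxK mulmxA -ZE; exact: frob_diag.
have BB : frob (N *m (U *m A *m U^T)) (N *m (U *m A *m U^T)) =
    \sum_j d 0 j ^+ 2 * \sum_i Z i j ^+ 2.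
  rewrite BE frob_mulr trmx_mul trmxK -!mulmxA (mulmxA U^T) UU mul1mx QQ mulmx1.
  rewrite frobE; apply: eq_bigr => j _; rewrite mulr_sumr; apply: eq_bigr => i _.
  by rewrite mul_mx_diag !mxE; ring.
have S0 j : 0 <= \sum_i Z i j ^+ 2 by apply: sumr_ge0 => i _; exact: sqr_ge0.
have s1 : sigma 1 A = d 0 ord0 := sg ord0.
have sr : sigma r.+1 A = d 0 ord_max := sg ord_max.
move=> B; rewrite /B NB BB s1 sr; split.
- by apply: sumr_ge0 => j _; rewrite mulr_ge0// ltW.
- rewrite mulr_sumr; apply: ler_sum => j _; rewrite mulrA.
  apply: ler_wpM2r => //; rewrite expr2; apply: ler_wpM2r; first exact: ltW.
  by apply: sd; exact: leq_ord.
- rewrite mulr_sumr; apply: ler_sum => j _; rewrite mulrA.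
  apply: ler_wpM2r => //; rewrite expr2; apply: ler_wpM2r; first exact: ltW.
  by apply: sd.
Qed.

(** The product equals |b^T N a|^2; it is the cross term in the square of the tangent map. *)
Lemma frob_psd_ge0 m n q q' (N : 'M[K]_(m, n)) (a : 'M[K]_(n, q)) (b : 'M[K]_(m, q')) :
  0 <= frob (N *m (a *m a^T)) (b *m b^T *m N).
Proof.
rewrite -(mulmxA b) frob_mull frobC !mulmxA frob_mulr trmxK.
exact: frob_ge0.
Qed.

End Bounds.

Section Quotient_bounds.
Context {K : realType} (p1 p2 r : nat).
Local Notation total := ('M[K]_(p1, r) * 'M[K]_(p2, r))%type.
Implicit Types (x y : total) (N : 'M[K]_(p1, p2)).

(** The columns of [Ub] lie in the column space of [L], and both spaces have dimension [m]. So [L]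
    has its columns in the span of [U], where U U^T is the identity. *)
Lemma col_proj p m (L : 'M[K]_(p, m)) (Ub U : 'M[K]_(p, m)) (C : 'M[K]_m) :
  \rank L = m -> stiefel Ub -> stiefel U -> Ub = L *m C -> (U^T == Ub^T)%MS ->
  U *m (U^T *m L) = L.
Proof.
move=> rL sUb sU UbE /andP[_ Ub_U].
have rUb : \rank Ub^T = m.
  apply/eqP; rewrite eqn_leq rank_leq_row/= -{1}(mxrank1 K m) -[X in \rank X]sUb.
  exact: mxrankM_maxl.
have /mxrank_leqif_sup[_ e] : (Ub^T <= L^T)%MS by rewrite UbE trmx_mul submxMl.
have L_Ub : (L^T <= Ub^T)%MS by rewrite -e rUb mxrank_tr rL.
have /submxP[D LD] := submx_trans L_Ub Ub_U.
have -> : L = U *m D^T by rewrite -[LHS]trmxK LD trmx_mul trmxK.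
by rewrite (mulmxA U^T) sU mul1mx.
Qed.

(** The product has rank r, so its first r singular values can be divided out of X Vb = Ub S; this
    puts [Ub] in the column space of L, and symmetrically [Vb] in that of R. *)
Lemma top_singular_subspaces_proj x (U : 'M[K]_(p1, r)) (Vs : 'M[K]_(p2, r)) :
  total_space x -> stiefel U -> stiefel Vs ->
  top_singular_subspaces (product x) U Vs ->
  U *m (U^T *m x.1) = x.1 /\ Vs *m (Vs^T *m x.2) = x.2.
Proof.
move=> xt sU sV [Ub [Vb [sUb sVb XV XU [eU eV]]]]; have [x1 x2] := xt.
set S := diag_mx _ in XV XU.
have Su : S \in unitmx.
  rewrite unitmxE unitfE det_diag; apply/prodf_neq0 => i _.
  by rewrite mxE gt_eqF// sigma_gt0// product_rank.
split.
  apply: (@col_proj _ _ _ Ub _ (x.2^T *m Vb *m invmx S)) => //.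
  by rewrite !mulmxA -/(product x) XV mulmxK.
apply: (@col_proj _ _ _ Vb _ (x.1^T *m Ub *m invmx S)) => //.
rewrite !mulmxA; have -> : x.2 *m x.1^T = (product x)^T.
  by rewrite /product trmx_mul trmxK.
by rewrite XU mulmxK.
Qed.

Variables W V : total -> 'M[K]_r.
Hypothesis wP : forall x, total_space x -> pos_def (W x) /\ pos_def (V x).
Variables (U : 'M[K]_(p1, r)) (Vs : 'M[K]_(p2, r)) (x : total).
Hypothesis xt : total_space x.
Hypothesis sU : stiefel U.
Hypothesis sV : stiefel Vs.
Hypothesis UP : U *m (U^T *m x.1) = x.1.
Hypothesis VP : Vs *m (Vs^T *m x.2) = x.2.

Lemma proj_unit p (A B : 'M[K]_(p, r)) : \rank B = r -> A *m (A^T *m B) = B ->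
  A^T *m B \in unitmx.
Proof.
move=> rB e; rewrite -row_full_unit /row_full eqn_leq rank_leq_col/= -{1}rB -{1}e.
exact: mxrankM_maxr.
Qed.

Lemma left_gram_pos_def : pos_def (left_gram V U x).
Proof.
apply: pos_def_congr; first by apply: pos_def_inv; case: (wP xt).
by apply: proj_unit => //; case: xt.
Qed.

Lemma right_gram_pos_def : pos_def (right_gram W Vs x).
Proof.
apply: pos_def_congr; first by apply: pos_def_inv; case: (wP xt).
by apply: proj_unit => //; case: xt.
Qed.

Lemma left_gramE : U *m left_gram V U x *m U^T = x.1 *m invmx (V x) *m x.1^T.
Proof.
rewrite -{1 2}UP; set P := U^T *m x.1.
by rewrite /left_gram -/P (trmx_mul U) !mulmxA.
Qed.

Lemma right_gramE : Vs *m right_gram W Vs x *m Vs^T = x.2 *m invmx (W x) *m x.2^T.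
Proof.
rewrite -{1 2}VP; set P := Vs^T *m x.2.
by rewrite /right_gram -/P (trmx_mul Vs) !mulmxA.
Qed.

Lemma tangent_map_hfield N :
  tangent_map x (hfield W V N x) =
    x.1 *m invmx (V x) *m x.1^T *m N + N *m (x.2 *m invmx (W x) *m x.2^T).
Proof.
rewrite /tangent_map /hfield/= !trmx_mul trmxK trmx_inv (V_sym wP xt).
by rewrite !mulmxA.
Qed.

End Quotient_bounds.

Lemma tangent_map_bounds (K : realType) (p1 p2 r : nat)
    (W V : 'M[K]_(p1, r) * 'M[K]_(p2, r) -> 'M[K]_r)
    (U : 'M[K]_(p1, r)) (Vs : 'M[K]_(p2, r)) x theta : (0 < r)%N ->
  (forall x, total_space x -> pos_def (W x) /\ pos_def (V x)) ->
  total_space x -> stiefel U -> stiefel Vs ->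
  U *m (U^T *m x.1) = x.1 -> Vs *m (Vs^T *m x.2) = x.2 ->
  horizontal W V x theta ->
  gamma W V U Vs x * total_metric W V x theta theta <=
    frob (tangent_map x theta) (tangent_map x theta) <=
  2 * Gamma W V U Vs x * total_metric W V x theta theta.
Proof.
case: r W V U Vs x theta => // r W V U Vs x theta _ wP xt sU sV UP VP thH.
have [N ->] := horizontal_hfield wP xt thH.
rewrite (hfield_metric wP)// (tangent_map_hfield wP)//.
have [SW SWE] := pos_def_sqrt (pos_def_inv (wP x xt).1).
have [SV SVE] := pos_def_sqrt (pos_def_inv (wP x xt).2).
(* Dropping this nonnegative cross term gives the lower bound without any loss in the constant. *)
have c0 : 0 <= frob (N *m (x.2 *m invmx (W x) *m x.2^T)) (x.1 *m invmx (V x) *m x.1^T *m N).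
  have -> : x.2 *m invmx (W x) *m x.2^T = (x.2 *m SW) *m (x.2 *m SW)^T.
    by rewrite SWE trmx_mul !mulmxA.
  have -> : x.1 *m invmx (V x) *m x.1^T = (x.1 *m SV) *m (x.1 *m SV)^T.
    by rewrite SVE trmx_mul !mulmxA.
  exact: frob_psd_ge0.
move: c0; rewrite -(left_gramE _ UP) -(right_gramE _ VP).
have [a0 a1 a2] := psd_bounds N sV (right_gram_pos_def wP xt VP).
have [b0 b1 b2] := psd_bounds N^T sU (left_gram_pos_def wP xt UP).
set RG := Vs *m _ *m _ in a0 a1 a2 *; set LG := U *m _ *m _ in b0 b1 b2 *.
have sLG : LG^T = LG.
  have [sG _] := left_gram_pos_def wP xt UP.
  by rewrite /LG (trmx_mul (U *m _)) (trmx_mul U) trmxK sG mulmxA.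
have eN : N^T *m LG = (LG *m N)^T by rewrite trmx_mul sLG.
move: b0 b1 b2; rewrite eN !frob_tr => b0 b1 b2 c0.
(* This bounds twice the cross term by the sum of the two squares, which is the origin of the factor
   2 in the upper bound. *)
have d0 := frob_ge0 (N *m RG - LG *m N).
move: a0 a1 a2 b0 b1 b2 c0 d0.
rewrite !frobBl !frobBr !frobDl !frobDr (frobC (LG *m N) (N *m RG)).
rewrite /gamma /Gamma; set g1 := sigma r.+1 (right_gram _ _ _).
set g2 := sigma r.+1 (left_gram _ _ _); set G1 := sigma 1 (right_gram _ _ _).
set G2 := sigma 1 (left_gram _ _ _).
set a := frob N (N *m RG); set b := frob N (LG *m N).
set aa := frob (N *m RG) (N *m RG); set bb := frob (LG *m N) (LG *m N).
set c := frob (N *m RG) (LG *m N) => a0 a1 a2 b0 b1 b2 c0 d0.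
have m1 : Num.min g1 g2 * a <= g1 * a by rewrite ler_wpM2r// ge_min lexx.
have m2 : Num.min g1 g2 * b <= g2 * b by rewrite ler_wpM2r// ge_min lexx orbT.
have M1 : G1 * a <= Num.max G1 G2 * a by rewrite ler_wpM2r// le_max lexx.
have M2 : G2 * b <= Num.max G1 G2 * b by rewrite ler_wpM2r// le_max lexx orbT.
by apply/andP; split; lra.
Qed.

(** * Constancy of gamma and Gamma on a fiber *)

Section Gram_invariance.
Context {K : realType} (p1 p2 r : nat).
Local Notation total := ('M[K]_(p1, r) * 'M[K]_(p2, r))%type.
Variables W V : total -> 'M[K]_r.
Hypothesis wt : weights W V.
Hypothesis winv : weights_invariant W V.

(** Moving along the fiber by M replaces P_2 by P_2 M^-T and, by the weight law, W^-1 by M^T W^-1 M,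
    so M cancels; the other Gram matrix is dual. *)
Lemma grams_invariant (U : 'M[K]_(p1, r)) (Vs : 'M[K]_(p2, r)) (x y : total) :
  total_space x -> product y = product x ->
  left_gram V U y = left_gram V U x /\ right_gram W Vs y = right_gram W Vs x.
Proof.
move=> xt yx; have yt : total_space y by apply: rank_product; rewrite yx product_rank.
have [M Mu ->] := factor_act xt yt (esym yx).
have [iW iV] := weights_inv wt winv xt Mu.
rewrite /left_gram /right_gram iW iV; split.
  by rewrite /act/= !trmx_mul !mulmxA.
by rewrite /act/= !trmx_mul !trmxK -trmx_inv !mulmxA.
Qed.

(** Every factorization of a rank-r product has factors of full rank and lies in the orbit of [x],
    so the supremum is over a singleton. *)
Lemma gamma_supE (U : 'M[K]_(p1, r)) (Vs : 'M[K]_(p2, r)) (x : total) :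
  total_space x -> gamma_sup W V U Vs (product x) = gamma W V U Vs x.
Proof.
move=> xt; rewrite /gamma_sup -[RHS]sup1; congr sup; apply/seteqP; split.
  move=> _ [y yx <-]; have [e1 e2] := grams_invariant U Vs xt yx.
  by rewrite /gamma e1 e2.
by move=> _ ->; exists x.
Qed.

Lemma Gamma_infE (U : 'M[K]_(p1, r)) (Vs : 'M[K]_(p2, r)) (x : total) :
  total_space x -> Gamma_inf W V U Vs (product x) = Gamma W V U Vs x.
Proof.
move=> xt; rewrite /Gamma_inf -[RHS]inf1; congr inf; apply/seteqP; split.
  move=> _ [y yx <-]; have [e1 e2] := grams_invariant U Vs xt yx.
  by rewrite /Gamma e1 e2.
by move=> _ ->; exists x.
Qed.

End Gram_invariance.

(** * Bases of the tangent spaces *)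

Section Bases.
Context {K : realType}.

Lemma lincomb_linear (E F : normedModType K) (J : E -> F) d (e : 'I_d -> E) a :
  (forall c u v, J (c *: u + v) = c *: J u + J v) ->
  J (lincomb e a) = lincomb (fun i => J (e i)) a.
Proof.
move=> Jlin; have J0 : J 0 = 0.
  by have := Jlin (-1) 0 0; rewrite scaler0 addr0 scaleN1r addNr.
rewrite /lincomb; elim: (index_enum _) => [|i s IH]; first by rewrite !big_nil.
by rewrite !big_cons Jlin IH.
Qed.

Lemma is_basis_image (E F : normedModType K) (H : set E) (H' : set F)
    (J : E -> F) d (e : 'I_d -> E) :
  (forall c u v, J (c *: u + v) = c *: J u + J v) ->
  (forall u, H u -> J u = 0 -> u = 0) ->
  (forall w, H' w <-> exists2 v, H v & w = J v) ->
  is_basis H e -> is_basis H' (fun i => J (e i)).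
Proof.
move=> Jlin Jinj HJ He.
have Jsum a : J (lincomb e a) = lincomb (fun i => J (e i)) a.
  exact: lincomb_linear.
split=> [w|a].
  split=> [/HJ[v /(basis_coord He)[a ->] ->]|[a ->]].
    by exists (a 0); rewrite Jsum.
  apply/HJ; exists (lincomb e (\row_i a i)); first exact: basis_mem.
  by rewrite Jsum -lincombE.
rewrite lincombE -Jsum => /(Jinj _ (basis_mem He _))/(basis_eq0 He) a0 i.
by have /rowP/(_ i) := a0; rewrite !mxE.
Qed.

End Bases.

Section Horizontal_basis.
Context {K : realType} (p1 p2 r : nat).
Local Notation total := ('M[K]_(p1, r) * 'M[K]_(p2, r))%type.
Variables (W V : total -> 'M[K]_r) (x : total).
Hypothesis wP : forall x, total_space x -> pos_def (W x) /\ pos_def (V x).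
Hypothesis xt : total_space x.

Let phi (theta : total) : 'M[K]_r :=
  x.1^T *m theta.1 *m W x - V x *m theta.2^T *m x.2.

Let phi_linear : linear phi.
Proof.
move=> c u v; rewrite /phi/= [(c *: u.2 + v.2)^T]linearP/=.
rewrite !mulmxDr !mulmxDl -!scalemxAr -!scalemxAl.
by rewrite opprD addrACA scalerBr.
Qed.

Let phiL : {linear total -> 'M[K]_r} :=
  HB.pack phi (GRing.isLinear.Build K total 'M[K]_r _ phi phi_linear).

Let horizontal_phi theta : horizontal W V x theta <-> phi theta = 0.
Proof.
split=> [/(horizontalP wP _ xt) H|/eqP]; first by rewrite /phi H subrr.
by rewrite subr_eq0 => /eqP H; apply/(horizontalP wP).
Qed.

(** The horizontal space is the kernel of [phi], which maps onto all r x r matrices already from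
    vectors with zero second component. This leaves dimension p1 r + p2 r - r^2. *)
Lemma horizontal_basis : exists e : 'I_((p1 + p2 - r) * r) -> total,
  is_basis (horizontal W V x) e.
Proof.
have [x1 x2] := xt; pose k := lker (linfun phiL).
have memk v : v \in k <-> horizontal W V x v.
  rewrite memv_ker lfunE; split=> [/eqP h|/horizontal_phi h].
    exact/horizontal_phi.
  exact/eqP.
have dk : \dim k = ((p1 + p2 - r) * r)%N.
  have surj : limg (linfun phiL) = fullv.
    apply/vspaceP => Z; rewrite memvf; apply/memv_imgP.
    exists ((linv x.1)^T *m Z *m invmx (W x), 0); rewrite ?memvf// lfunE/= /phi/=.
    rewrite trmx0 mulmx0 mul0mx subr0 !mulmxA -trmx_mul linvK// trmx1 mul1mx.
    by rewrite mulmxKV// (W_unit wP).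
  have := limg_ker_dim (linfun phiL) fullv.
  rewrite surj capfv -/k !dimvf => e.
  have {}e : (\dim k + r * r = p1 * r + p2 * r)%N by exact: e.
  by rewrite mulnBl mulnDl -e addnK.
have bk : basis_of k (vbasis k) := vbasisP k.
have fk := basis_free bk.
rewrite -dk; exists (fun i => (vbasis k)`_i); split=> [v|a a0 i].
  split=> [/memk vk|[a ->]].
    by exists (fun i => coord (vbasis k) i v); exact: coord_vbasis.
  apply/memk; apply: memv_suml => i _; apply: memvZ; apply: vbasis_mem.
  by rewrite mem_nth// size_tuple.
by move/freeP : fk => /(_ a a0).
Qed.

(** On vertical vectors [phi] becomes an endomorphism of the r x r matrices. It is injective because
    a vector both vertical and horizontal has norm zero, hence surjective, so some vertical vector
    has the same [phi] as [theta]. *)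
Lemma horizontal_complement theta : exists A : 'M[K]_r,
  horizontal W V x (theta - (x.1 *m A, - (x.2 *m A^T))).
Proof.
have [x1 x2] := xt.
pose psi (A : 'M[K]_r) := phi (x.1 *m A, - (x.2 *m A^T)).
have psi_linear : linear psi.
  move=> c A B; rewrite /psi -phi_linear; congr phi; congr pair => /=.
    by rewrite mulmxDr scalemxAr.
  by rewrite linearP/= mulmxDr opprD -scalemxAr scalerN.
pose psiL : {linear 'M[K]_r -> 'M[K]_r} :=
  HB.pack psi (GRing.isLinear.Build K 'M[K]_r 'M[K]_r _ psi psi_linear).
have inj A : psi A = 0 -> A = 0.
  move=> A0; set v : total := (x.1 *m A, - (x.2 *m A^T)).
  have vH : horizontal W V x v by apply/horizontal_phi.
  have vT : tangent_space (fiber x) x v by apply/tangent_fiber => //; exists A.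
  have v0 : v = 0.
    apply/eqP; apply: contraT => /(total_metric_gt0 wP xt).
    by rewrite vH// ltxx.
  have : x.1 *m A = 0 by have := congr1 fst v0.
  by move=> /(congr1 (mulmx (linv x.1))); rewrite mulmxA linvK// mul1mx mulmx0.
have lk : lker (linfun psiL) == 0%VS.
  apply/lker0P => A B; rewrite !lfunE/= => AB; apply/eqP; rewrite -subr_eq0.
  by apply/eqP/inj; rewrite -[psi _]/(psiL _) linearB/= AB subrr.
have /vspaceP/(_ (phi theta)) := lker0_limgf lk.
rewrite memvf => /memv_imgP[A _]; rewrite lfunE/= => phiA.
exists A; apply/horizontal_phi.
by rewrite -[LHS]/(phiL _) linearB/= phiA subrr.
Qed.

Lemma tangent_map_lin c (u v : total) :
  tangent_map x (c *: u + v) = c *: tangent_map x u + tangent_map x v.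
Proof.
rewrite /tangent_map/= [(c *: u.2 + v.2)^T]linearP/= !mulmxDr !mulmxDl.
by rewrite -!scalemxAr -!scalemxAl scalerDr addrACA.
Qed.

Lemma tangent_map_horizontal w :
  tangent_space (fixed_rank r) (product x) w <->
  exists2 theta, horizontal W V x theta & w = tangent_map x theta.
Proof.
split=> [/(tangent_fixed_rank _ xt)[theta ->]|[theta _ ->]]; last first.
  by apply/tangent_fixed_rank => //; exists theta.
have [A tH] := horizontal_complement theta.
exists (theta - (x.1 *m A, - (x.2 *m A^T))) => //.
rewrite addrC -scaleN1r tangent_map_lin.
rewrite (_ : tangent_map x (x.1 *m A, - (x.2 *m A^T)) = 0) ?scaler0 ?add0r//.
by rewrite /tangent_map/= linearN/= trmx_mul trmxK mulmxN mulmxA addNr.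
Qed.

(** For [theta] of the form N(x), the squared norm is <N, T theta>, which vanishes with T theta. *)
Lemma tangent_map_inj theta : horizontal W V x theta ->
  tangent_map x theta = 0 -> theta = 0.
Proof.
move=> /(horizontal_hfield wP xt)[N ->] T0; apply/eqP; apply: contraT.
by move=> /(total_metric_gt0 wP xt); rewrite (hfield_metric wP)// T0 frob0r ltxx.
Qed.

End Horizontal_basis.

(** * Gradients, Hessians and the eigenvalue comparison *)

Theorem theorem5 (K : realType) (p1 p2 r : nat)
  (f : 'M[K]_(p1, p2) -> K)
  (W V : 'M[K]_(p1, r) * 'M[K]_(p2, r) -> 'M[K]_r)
  (L : 'M[K]_(p1, r)) (R : 'M[K]_(p2, r))
  (U : 'M[K]_(p1, r)) (Vs : 'M[K]_(p2, r)) :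
  (1 <= r <= minn p1 p2)%N ->
  Ck 2 setT f ->
  weights W V ->
  weights_invariant W V ->
  \rank L = r -> \rank R = r ->
  stiefel U -> stiefel Vs ->
  top_singular_subspaces (L *m R^T) U Vs ->
  let x := (L, R) in
  let X := L *m R^T in
  let d := ((p1 + p2 - r) * r)%N in
  let Me := embedded_geometry p1 p2 r in
  let Mq := quotient_geometry W V in
  let h := lifted_objective f in
  let gradf := rgrad Me f X in
  let gradh := rgrad Mq h x in
  gradf = gradh.1 *m W x *m mp_inverse R
          + (gradh.2 *m V x *m mp_inverse L)^T *m (1%:M - R *m mp_inverse R) /\
  gradh = (gradf *m R *m invmx (W x), gradf^T *m L *m invmx (V x)) /\
  (forall nabla_e nabla_q,
     levi_civita Me nabla_e -> levi_civita Mq nabla_q ->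
     gradh = 0 ->
     (forall theta, horizontal W V x theta ->
        rhess_form Mq nabla_q h x theta theta =
        rhess_form Me nabla_e f X (tangent_map x theta) (tangent_map x theta)) /\
     let eig_h := eigenvalues (horizontal W V x) (rhess Mq nabla_q h x) in
     let eig_f := eigenvalues (tangent_space (fixed_rank r) X)
                    (rhess Me nabla_e f X) in
     [/\ size eig_h = d, size eig_f = d
       & forall i, (1 <= i <= d)%N ->
           sandwiched (entry i eig_h)
             (gamma_sup W V U Vs X * entry i eig_f)
             (2 * Gamma_inf W V U Vs X * entry i eig_f)]).
Proof.
move=> /andP[r0 _] Cf wt winv rL rR sU sV tss x X d Me Mq h gradf gradh.
have xt : total_space x by [].
have wP y : total_space y -> pos_def (W y) /\ pos_def (V y) by case: wt => _ _; apply.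
have df Y : differentiable f Y by exact: Cf.1.
split; [|split].
- rewrite !mp_inverse_linv//; exact: (rgrad_embedded_quotient Cf wt xt).
- exact: (rgrad_quotient wP xt (df X)).
move=> nabla_e nabla_q lce lcq crit.
have hess_eq := rhess_quotient_embedded Cf wt winv xt crit lce lcq.
have hessC := rhess_quotientC Cf wt winv xt crit lcq.
split=> [theta thH|eig_h eig_f]; first exact: hess_eq.
have [e He] := horizontal_basis wP xt.
have Jlin := @tangent_map_lin K p1 p2 r x.
have tanP := tangent_map_horizontal wP xt.
(* The tangent map is an isomorphism from the horizontal space to the tangent space, so both
   operators get bases of length [d]. *)
have HeT := is_basis_image Jlin (@tangent_map_inj _ _ _ _ W V x wP xt) tanP He.
have gq := rgrad_quotient_field wt winv Cf.
have ge := rgrad_embedded_field r Cf.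
have TqH v : horizontal W V x v -> horizontal W V x (rhess Mq nabla_q h x v).
  by move=> vH; exact: (lc_tangent lcq).
have Tqlin c u v : horizontal W V x u -> horizontal W V x v ->
    rhess Mq nabla_q h x (c *: u + v) =
    c *: rhess Mq nabla_q h x u + rhess Mq nabla_q h x v.
  by move=> uH vH; exact: (lc_linear lcq).
have Xr : fixed_rank r X by exact: (product_rank xt).
have TeH v : tangent_space (fixed_rank r) X v ->
    tangent_space (fixed_rank r) X (rhess Me nabla_e f X v).
  by move=> vT; exact: (lc_tangent lce).
have Telin c u v : tangent_space (fixed_rank r) X u ->
    tangent_space (fixed_rank r) X v -> rhess Me nabla_e f X (c *: u + v) =
    c *: rhess Me nabla_e f X u + rhess Me nabla_e f X v.
  by move=> uH vH; exact: (lc_linear lce).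
have Tqsym u v : horizontal W V x u -> horizontal W V x v ->
    total_metric W V x (rhess Mq nabla_q h x u) v =
    total_metric W V x u (rhess Mq nabla_q h x v).
  by move=> uH vH; rewrite [RHS](total_metricC wP)//; exact: hessC.
(* Every tangent vector is the image of a horizontal one, so the symmetry of Hess h carries over to
   Hess f. *)
have Tesym u v : tangent_space (fixed_rank r) X u ->
    tangent_space (fixed_rank r) X v ->
    frob (rhess Me nabla_e f X u) v = frob u (rhess Me nabla_e f X v).
  move=> /tanP[a aH ->] /tanP[b bH ->]; rewrite [RHS]frobC.
  by have := hessC _ _ aH bH; rewrite !hess_eq.
have frobP c (u v w : 'M[K]_(p1, p2)) : frob (c *: u + v) w = c * frob u w + frob v w.
  by rewrite frobDl frobZl.
have frob_gt0 (u : 'M[K]_(p1, p2)) : u != 0 -> 0 < frob u u.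
  move=> u0; rewrite lt0r frob_ge0 andbT; apply: contra_neq u0; exact: frob_eq0.
have [bq [la [Hbq nq eq hq sla]]] := orthonormal_eigenbasis TqH Tqlin
  (total_metricP W V x) (fun u v => total_metricC wP u v xt)
  (fun u => @total_metric_gt0 _ _ _ _ W V wP x u xt) He Tqsym.
have [be [mu [Hbe ne ee hE smu]]] := orthonormal_eigenbasis TeH Telin
  frobP (@frobC K p1 p2) frob_gt0 HeT Tesym.
have eig_hE : eig_h = [seq la 0 i | i <- enum 'I_d] by exact: (eigenvaluesE Tqlin Hbq eq sla).
have eig_fE : eig_f = [seq mu 0 i | i <- enum 'I_d] by exact: (eigenvaluesE Telin Hbe ee smu).
have Hbqi i : horizontal W V x (bq i).
  by rewrite -(lincomb_delta bq); exact: basis_mem.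
have /choice[P HP] i : exists a, tangent_map x (bq i) = lincomb be a.
  by apply: (basis_coord Hbe); apply/tanP; exists (bq i).
(* The matrix of the tangent map in the two orthonormal eigenbases. Through it [hess_eq] becomes a
   congruence of diagonal forms, and the norm bounds become the remaining hypotheses of
   [ostrowski]. *)
pose M := \matrix_i P i.
have JM a : tangent_map x (lincomb bq a) = lincomb be (a *m M).
  rewrite lincomb_linear// -lincomb_mulmx; apply: eq_bigr => i _.
  by rewrite rowK HP.
have [UP VP] := top_singular_subspaces_proj xt sU sV tss.
have bounds a := tangent_map_bounds r0 wP xt sU sV UP VP (basis_mem Hbq a).
have O k : sandwiched (la 0 k) (gamma W V U Vs x * mu 0 k) (2 * Gamma W V U Vs x * mu 0 k).
  apply: (@ostrowski _ _ la mu M) => // a.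
  - rewrite -hq -hE -JM; apply: hess_eq; exact: basis_mem.
  - by have := bounds a; rewrite nq JM ne => /andP[].
  - by have := bounds a; rewrite nq JM ne => /andP[].
split.
- by rewrite eig_hE size_map size_enum_ord.
- by rewrite eig_fE size_map size_enum_ord.
(* [entry] counts from 1, so the index i + 1 corresponds to the ordinal [i]. *)
move=> [//|i] /andP[_ id].
rewrite (gamma_supE wt winv U Vs xt) (Gamma_infE wt winv U Vs xt) /entry/=.
have := O (Ordinal id).
by rewrite eig_hE eig_fE -(nth_enum_rV la) -(nth_enum_rV mu).
Qed.
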